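(* Let $K$ be a field, $S$ a positive normal affine semigroup, $R=K[S]$, and $\sigma: R\to P=K[X_1,\dots,X_s]$ the standard embedding. Furthermore let $\mathfrak{m}$ be the irrelevant maximal ideal of $R$ generated by all non-unit monomials, and $\lambda$ the maximal length of an $R$-sequence consisting of monomials. Then $$ \lambda\le \operatorname{grade} \mathfrak{m} P = \min\{\operatorname{depth} M_c: c\in\operatorname{Cl}(R)\}. $$
   Context: Semigroups are commutative, written additively, with $0$. An affine semigroup is a finitely generated subsemigroup of some $\mathbb{Z}^n$; $\operatorname{gp}(S)$ is its group of differences; $S$ is normal if every $x\in\operatorname{gp}(S)$ with $mx\in S$ for some integer $m>0$ lies in $S$, and positive if $0$ is its only invertible element. Identify $\operatorname{gp}(S)=\mathbb{Z}^r$, $r=\operatorname{rank}S$, and let $C(S)\subset\mathbb{R}^r$ be the cone generated by $S$. The support forms $\sigma_1,\dots,\sigma_s$ of $S$ are the (unique up to order) linear forms on $\mathbb{R}^r$ with coprime integer coefficients such that $C(S)=\{x:\sigma_i(x)\ge0,\ i=1,\dots,s\}$ is an irredundant representation. Put $\sigma=(\sigma_1,\dots,\sigma_s):\mathbb{Z}^r\to\mathbb{Z}^s$; it maps $S$ into $\mathbb{Z}_+^s$ and induces the standard embedding $\sigma:K[S]\to K[\mathbb{Z}_+^s]=K[X_1,\dots,X_s]$, through which $R$ is regarded as a subring of $P$. Monomials of $R$ are the elements of $S$. $\operatorname{Cl}(R)$ is the divisor class group of $R$, identified with $\mathbb{Z}^s/\sigma(\mathbb{Z}^r)$ by sending the class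 of the divisorial ideal with $K$-basis $\{x\in\operatorname{gp}(S):\sigma_i(x)\ge a_i,\ i=1,\dots,s\}$ to the residue class of $a\in\mathbb{Z}^s$. For $c\in\operatorname{Cl}(R)$, $M_c$ is the $R$-submodule of $P$ spanned over $K$ by all monomials whose exponent vector has residue class $-c$; it is isomorphic to a divisorial ideal of class $c$. $\operatorname{grade}I$ is the length of a maximal regular sequence (of the ambient noetherian ring) contained in $I$. $\operatorname{depth}M=\operatorname{depth}_{R_\mathfrak{m}}M_\mathfrak{m}$. *)

(* Defs.v *)
From HB Require Import structures.
From mathcomp Require Import all_boot all_order all_algebra.
From mathcomp Require Import fraction generic_quotient ring_quotient.
From mathcomp Require Import boolp reals.
From mathcomp.multinomials Require Import monalg mpoly.

Set Implicit Arguments.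
Unset Strict Implicit.
Unset Printing Implicit Defensive.

Import Order.TTheory GRing.Theory Num.Theory.
Local Open Scope ring_scope.
Local Open Scope quotient_scope.

Definition is_max (L : nat -> Prop) (k : nat) : Prop :=
  L k /\ forall l, L l -> (l <= k)%N.

Definition is_min (L : nat -> Prop) (k : nat) : Prop :=
  L k /\ forall l, L l -> (k <= l)%N.

(** * Regular sequences, grade, depth *)

Section RegularSequences.
Variable A : comNzRingType.
Implicit Types (M I X : A -> Prop) (f : seq A).

(* The submodule (f_1, ..., f_k) M. *)
Definition seq_mul M f (y : A) : Prop :=
  exists u : 'I_(size f) -> A,
    (forall i, M (u i)) /\ y = \sum_(i < size f) f`_i * u i.

(* Here M is a submodule of A over some subring of A that contains the entries
   of f; this covers modules over A itself as well as the localized modules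
   below, which live in a field of fractions. *)
Definition regular_seq M f : Prop :=
  (forall i, (i < size f)%N -> forall y, M y ->
     seq_mul M (take i f) (f`_i * y) -> seq_mul M (take i f) y)
  /\ exists y, M y /\ ~ seq_mul M f y.

Definition regular_length M I (k : nat) : Prop :=
  exists f, [/\ size f = k, forall a, a \in f -> I a & regular_seq M f].

Definition ideal_gen X (y : A) : Prop :=
  exists (k : nat) (u a : 'I_k -> A),
    (forall i, X (a i)) /\ y = \sum_i u i * a i.

Definition is_grade I (g : nat) : Prop :=
  is_max (regular_length (fun=> True) I) g.

End RegularSequences.

Section LocalDepth.
Variables (R : comNzRingType) (A : idomainType) (h : R -> A).
Implicit Types (m : R -> Prop) (M : A -> Prop).

(* For an injective ring morphism h, a prime ideal m of R and an R-submodule M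
   of the domain A, the localization M_m is realized inside Frac(A). *)
Definition localization m M (y : {fraction A}) : Prop :=
  exists (x : A) (t : R), [/\ M x, ~ m t & y = tofrac x / tofrac (h t)].

Definition local_max_ideal m : {fraction A} -> Prop :=
  localization m (fun x => exists a, m a /\ x = h a).

(* depth of M_m over the local ring R_m *)
Definition is_local_depth m M (d : nat) : Prop :=
  is_max (regular_length (localization m M) (local_max_ideal m)) d.

End LocalDepth.

(** * Positive normal affine semigroups *)

Definition finitely_generated n (S : {pred 'rV[int]_n}) : Prop :=
  exists (k : nat) (e : 'I_k -> 'rV[int]_n),
    forall x, x \in S <-> exists a : 'I_k -> nat, x = \sum_i e i *+ a i.

(* Positivity is part of the structure because the semigroup algebras of the
   library require a monoid without nontrivial units. *)
Record posAffineSemigroup (n : nat) := PosAffineSemigroup {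
  pas_pred :> {pred 'rV[int]_n};
  pas_addr_closed : addr_closed pas_pred;
  pas_fg : finitely_generated pas_pred;
  pas_positive : forall x, x \in pas_pred -> - x \in pas_pred -> x = 0
}.

Definition gp n (S : posAffineSemigroup n) (x : 'rV[int]_n) : Prop :=
  exists y z, [/\ y \in S, z \in S & x = y - z].

Definition normal_semigroup n (S : posAffineSemigroup n) : Prop :=
  forall (x : 'rV[int]_n) (m : nat),
    gp S x -> (0 < m)%N -> x *+ m \in S -> x \in S.

Section SemigroupMonoid.
Variables (n : nat) (S : posAffineSemigroup n).

Definition sg_elt : Type := {x : 'rV[int]_n | x \in S}.
HB.instance Definition _ := Choice.on sg_elt.

Definition sg_one : sg_elt := exist _ 0 (pas_addr_closed S).1.
Definition sg_mul (x y : sg_elt) : sg_elt :=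
  exist _ (sval x + sval y)
    ((pas_addr_closed S).2 _ _ (svalP x) (svalP y)).

Lemma sg_mulA : associative sg_mul.
Proof. by move=> x y z; apply: val_inj; rewrite /= addrA. Qed.

Lemma sg_mulC : commutative sg_mul.
Proof. by move=> x y; apply: val_inj; rewrite /= addrC. Qed.

Lemma sg_mul1 : left_id sg_one sg_mul.
Proof. by move=> x; apply: val_inj; rewrite /= add0r. Qed.

Lemma sg_mulr1 : right_id sg_one sg_mul.
Proof. by move=> x; apply: val_inj; rewrite /= addr0. Qed.

Lemma sg_unit x y : sg_mul x y = sg_one -> x = sg_one /\ y = sg_one.
Proof.
move=> /(congr1 val) /= xy0.
have yE : sval y = - sval x by apply/eqP; rewrite -addr_eq0 addrC xy0.
have x0 : sval x = 0.
  by apply: pas_positive (svalP x) _; rewrite -yE (svalP y).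
by split; apply: val_inj => //=; rewrite yE x0 oppr0.
Qed.

HB.instance Definition _ := Choice_isMonomialDef.Build sg_elt
  sg_mulA sg_mul1 sg_mulr1 sg_unit.
HB.instance Definition _ := MonomialDef_isConomialDef.Build sg_elt sg_mulC.

End SemigroupMonoid.

Definition sg_alg (K : fieldType) n (S : posAffineSemigroup n) :
  comNzRingType := {malg K[sg_elt S]}.

Section SemigroupAlgebra.
Variables (K : fieldType) (n : nat) (S : posAffineSemigroup n).

Definition monomial (a : sg_alg K S) : Prop :=
  exists x : sg_elt S, a = mkmalgU x (1 : K).

Definition irrelevant_ideal : sg_alg K S -> Prop :=
  ideal_gen (fun a => monomial a /\ ~ exists b, a * b = 1).

Definition monomial_seq_length : nat -> Prop :=
  regular_length (fun=> True) monomial.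

End SemigroupAlgebra.

(** * Support forms and the standard embedding *)

(* phi restricts to a group isomorphism gp(S) -> Z^r; its values outside gp(S)
   are irrelevant. *)
Definition gp_identification n r (S : posAffineSemigroup n)
    (phi : 'rV[int]_n -> 'rV[int]_r) : Prop :=
  (forall x y, gp S x -> gp S y -> phi (x + y) = phi x + phi y)
  /\ forall z, exists! x, gp S x /\ phi x = z.

Section SupportForms.
Variables (F : realType) (n r s : nat) (S : posAffineSemigroup n).
Variables (phi : 'rV[int]_n -> 'rV[int]_r) (sigma : 'M[int]_(r, s)).

Definition real_cone (v : 'rV[F]_r) : Prop :=
  exists (k : nat) (x : 'I_k -> 'rV[int]_n) (a : 'I_k -> F),
    [/\ forall i, x i \in S, forall i, 0 <= a i
      & v = \sum_i a i *: map_mx intr (phi (x i))].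

(* The value at v of the form whose coefficients are the i-th column of
   sigma. *)
Definition form_at (i : 'I_s) (v : 'rV[F]_r) : F :=
  (v *m map_mx intr sigma) 0 i.

Definition support_forms : Prop :=
  [/\ forall i, \big[gcdn/0%N]_(j < r) `|sigma j i|%N = 1%N,
      forall v, real_cone v <-> forall i, 0 <= form_at i v
    & forall i, ~ (forall v,
        real_cone v <-> forall j, j != i -> 0 <= form_at j v)].

End SupportForms.

Section StandardEmbedding.
Variables (K : fieldType) (n r s : nat) (S : posAffineSemigroup n).
Variables (phi : 'rV[int]_n -> 'rV[int]_r) (sigma : 'M[int]_(r, s)).

(* When the columns of sigma are the support forms of S, the entries of
   phi x *m sigma are nonnegative and absz only changes their type. *)
Definition std_exponent (x : sg_elt S) : 'X_{1..s} :=
  [multinom `|(phi (sval x) *m sigma) ord0 i|%N | i < s].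

Definition std_embedding : sg_alg K S -> mpoly s K :=
  monalg.mmap (@mpolyC s K) (fun x => mpolyX K (std_exponent x)).

Definition extended_irrelevant_ideal : mpoly s K -> Prop :=
  ideal_gen (fun p => exists a, irrelevant_ideal a /\ p = std_embedding a).

End StandardEmbedding.

(** * The divisor class group Z^s / sigma(Z^r) and the modules M_c *)

Section ClassGroup.
Variables (r s : nat) (sigma : 'M[int]_(r, s)).

Definition form_image : {pred 'rV[int]_s} :=
  fun a => `[< exists z : 'rV[int]_r, a = z *m sigma >].

Lemma form_image_zmod_closed : zmod_closed form_image.
Proof.
split; first by apply/asboolP; exists 0; rewrite mul0mx.
move=> _ _ /asboolP[y ->] /asboolP[z ->].
by apply/asboolP; exists (y - z); rewrite mulmxBl.
Qed.

HB.instance Definition _ :=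
  GRing.isZmodClosed.Build 'rV[int]_s form_image form_image_zmod_closed.

Definition class_group : zmodType := Quotient.quot form_image.

Definition residue_class (a : 'rV[int]_s) : class_group :=
  \pi_(Quotient.quot form_image) a.

Definition class_module (K : fieldType) (c : class_group)
    (p : mpoly s K) : Prop :=
  forall m, m \in mpoly.msupp p ->
    residue_class (\row_i (m i)%:Z) = - c.

End ClassGroup.

Arguments irrelevant_ideal K {n} S a.
Arguments monomial_seq_length K {n} S k.
Arguments std_embedding K {n r s} S phi sigma a.
Arguments extended_irrelevant_ideal K {n r s} S phi sigma p.
Arguments class_module {r s sigma} K c p.

(* Main.v *)
Require Import Defs.
From mathcomp Require Import all_boot all_order all_algebra.
From mathcomp Require Import reals.
From mathcomp.multinomials Require Import monalg mpoly.
From HB Require Import structures.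
From mathcomp Require Import fraction ring_quotient boolp.
From mathcomp Require Import ring.

(** The grade of mP and the depth of M_c are both read off a single sequence x
    in m which is P-regular and maximal with this property. Since P is
    noetherian, m kills some y not in xP; the R-linear projections of y onto the
    direct summands M_c of P cannot all lie in xP, so some M_c has a nonzero
    socle modulo x, while x is regular on every M_c. That a regular sequence
    with nonzero socle is longest possible, with no finiteness condition on the
    module, follows from the Koszul complex on generators of m: passing to M/fM
    lowers by one the first degree in which Koszul cohomology is nonzero.

    For a monomial R-sequence the ideals (f_i) : f_j and (f_i) agree if i < j.
    A monomial in the interior of the facet sigma_t = 0 then shows that sigma_t
    cannot be positive on both f_i and f_j, so the images of the sequence in P
    are pairwise coprime monomials, hence a P-regular sequence in mP. *)

Set Implicit Arguments.
Unset Strict Implicit.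
Unset Printing Implicit Defensive.

Import Order.TTheory GRing.Theory Num.Theory.
Local Open Scope ring_scope.

(** * Submodules given by predicates *)

Section Submodules.
Variable A : comNzRingType.
Implicit Types (B M N I : A -> Prop) (f : seq A).

(** The sequence x is taken in the image of m, not merely in mP, because its entries must act on
    every M_c, which is stable under R only. The image of m is no ideal of P, so prime avoidance is
    proved for sets closed under addition and multiplication. Each M_c is cut out of P by the
    residue class of exponents, and M_c meets xP exactly in xM_c; this carries regularity from P
    down to M_c. Depth also requires that m(M_c) does not exhaust M_c after localization: a monomial
    of least degree in M_c shows this, a graded form of Nakayama's lemma. Modules are predicates on
    one ring [A] with scalars in a predicate [B], so that a single Koszul argument serves P over
    itself and the localized M_c over R_m inside the fraction field of P. Normality enters through a
    descent from real to rational coefficients: nonnegative support forms place a point in a real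
    cone, whereas membership in S needs an integral relation. *)

Definition submodule B N : Prop :=
  [/\ N 0, forall x y, N x -> N y -> N (x - y)
    & forall b x, B b -> N x -> N (b * x)].

Lemma submoduleN B N x : submodule B N -> N x -> N (- x).
Proof. by case=> N0 NB _ Nx; rewrite -[- x]add0r; apply: NB. Qed.

Lemma submoduleD B N x y : submodule B N -> N x -> N y -> N (x + y).
Proof.
move=> hN Nx Ny; rewrite -[y]opprK; have [_ NB _] := hN.
by apply: NB => //; apply: (submoduleN hN).
Qed.

Lemma submodule_sum B N (J : Type) (r : seq J) (F : J -> A) :
  submodule B N -> (forall i, N (F i)) -> N (\sum_(i <- r) F i).
Proof.
move=> hN hF; elim: r => [|i r IH]; rewrite ?big_nil ?big_cons.
  by case: hN.
exact: submoduleD hN (hF i) IH.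
Qed.

Definition add_mul N x M (y : A) : Prop :=
  exists u v, [/\ N u, M v & y = u + x * v].

Lemma submodule_add_mul B N x M :
  submodule B N -> submodule B M -> submodule B (add_mul N x M).
Proof.
move=> [N0 NB NZ] [M0 MB MZ]; split.
- by exists 0, 0; rewrite mulr0 addr0.
- move=> _ _ [u [v [Nu Mv ->]]] [u' [v' [Nu' Mv' ->]]].
  exists (u - u'), (v - v'); split; [exact: NB|exact: MB|ring].
- move=> b _ Bb [u [v [Nu Mv ->]]]; exists (b * u), (b * v).
  by split; [exact: NZ|exact: MZ|ring].
Qed.

(** Coefficients indexed by all of [nat] make concatenation and truncation painless; [M 0] pads them
    beyond the length of [f]. *)
Lemma seq_mulP M f y : M 0 ->
  seq_mul M f y <-> exists u : nat -> A,
    (forall i, M (u i)) /\ y = \sum_(0 <= i < size f) f`_i * u i.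
Proof.
move=> M0; split=> [[u [Mu ->]]|[u [Mu ->]]]; last first.
  by exists (fun i => u i); rewrite big_mkord.
exists (fun i => if insub i is Some j then u j else 0); split.
  by move=> i; case: insubP.
by rewrite big_mkord; apply: eq_bigr => i _; rewrite valK.
Qed.

Lemma seq_mul_nil M y : seq_mul M [::] y <-> y = 0.
Proof.
split=> [[u [_ ->]]|->]; first by rewrite big_ord0.
by exists (fun=> 0); split; [case|rewrite big_ord0].
Qed.

Lemma seq_mul_rcons M f x : M 0 ->
  seq_mul M (rcons f x) = add_mul (seq_mul M f) x M.
Proof.
move=> M0; apply/funext => y; apply/propext; split.
  move=> /(seq_mulP _ _ M0)[u [Mu ->]].
  rewrite size_rcons big_nat_recr //= nth_rcons ltnn eqxx.
  exists (\sum_(0 <= i < size f) f`_i * u i), (u (size f)); split => //.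
    by apply/seq_mulP => //; exists u.
  by congr (_ + _); apply: eq_big_nat => i /andP[_ lti]; rewrite nth_rcons lti.
move=> [_ [v [/(seq_mulP _ _ M0)[u [Mu ->]] Mv ->]]].
apply/seq_mulP => //; exists (fun i => if (i < size f)%N then u i else v).
split=> [i|]; first by case: ifP.
rewrite size_rcons big_nat_recr //= nth_rcons !ltnn eqxx; congr (_ + _).
by apply: eq_big_nat => i /andP[_ lti]; rewrite nth_rcons lti.
Qed.

Lemma submodule_seq_mul B M f : submodule B M -> submodule B (seq_mul M f).
Proof.
move=> hM; have [M0 _ _] := hM.
elim/last_ind: f => [|f x IH]; last first.
  by rewrite seq_mul_rcons //; apply: submodule_add_mul.
split=> [|x y /seq_mul_nil -> /seq_mul_nil ->|b x _ /seq_mul_nil ->];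
  by apply/seq_mul_nil; rewrite ?subrr ?mulr0.
Qed.

Lemma seq_mul_le M M' f y :
  (forall x, M x -> M' x) -> seq_mul M f y -> seq_mul M' f y.
Proof. by move=> hMM' [u [Mu ->]]; exists u; split=> // i; apply: hMM'. Qed.

Lemma regular_seq_rcons B M f x : submodule B M ->
  regular_seq M f ->
  (forall y, M y -> seq_mul M f (x * y) -> seq_mul M f y) ->
  (exists y, M y /\ ~ seq_mul M (rcons f x) y) ->
  regular_seq M (rcons f x).
Proof.
move=> hM [reg _] regx ex; split=> // i; rewrite size_rcons ltnS leq_eqVlt.
case/orP=> [/eqP ->|lti] y My; rewrite -cats1.
  by rewrite take_size_cat // nth_cat ltnn subnn /=; apply: regx.
by rewrite takel_cat 1?ltnW // nth_cat lti; apply: reg.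
Qed.

Lemma submodule_all B : submodule B (fun=> True).
Proof. by []. Qed.

Lemma regular_seq_nil M y : M y -> y != 0 -> regular_seq M [::].
Proof.
move=> My y0; split=> //; exists y; split=> //.
by move=> /seq_mul_nil /eqP; apply/negP.
Qed.

End Submodules.

(** * The Koszul complex *)

Section Koszul.
Variable A : comNzRingType.
Implicit Types (B M N : A -> Prop) (l : seq A).

(* The Koszul complex of x :: l is the mapping cone of multiplication by x on
   the Koszul complex of l. *)
Fixpoint koszul l : lmodType A :=
  if l is _ :: l' then (koszul l' * koszul l')%type else A^o.

Fixpoint koszul_d l : koszul l -> koszul l :=
  match l with
  | [::] => fun=> 0
  | x :: l' => fun u => (koszul_d u.1, x *: u.1 - koszul_d u.2)
  end.

(* Contraction with the functional taking the value b i on the i-th basis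
   vector. *)
Fixpoint koszul_h l (b : nat -> A) : koszul l -> koszul l :=
  match l with
  | [::] => fun=> 0
  | _ :: l' => fun u => (b 0%N *: u.2 + koszul_h (fun i => b i.+1) u.1,
                         - koszul_h (fun i => b i.+1) u.2)
  end.

(* Cochains of degree p - 1 with coefficients in M; the shift makes the cochain
   group of index 0 trivial. *)
Fixpoint koszul_in M l (p : nat) : koszul l -> Prop :=
  match l with
  | [::] => fun u => if p == 1%N then M u else u = 0
  | _ :: l' => fun u => koszul_in M p u.1 /\ koszul_in M p.-1 u.2
  end.

Fixpoint koszul_bot l (y : A) : koszul l :=
  match l with
  | [::] => y
  | _ :: l' => (koszul_bot l' y, 0)
  end.

Fixpoint koszul_top l (y : A) : koszul l :=
  match l with
  | [::] => y
  | _ :: l' => (0, koszul_top l' y)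
  end.

Fixpoint koszul_topc l : koszul l -> A :=
  match l with
  | [::] => fun u => u
  | _ :: l' => fun u => koszul_topc u.2
  end.

(** Vanishing of the cohomology in degree [p] of the Koszul complex of [l] with coefficients in M/N,
    expressed on representatives in M. The shift in [koszul_in] makes [v] zero when [p] is 0. *)
Definition exact_mod M N l p : Prop :=
  forall u : koszul l, koszul_in M p.+1 u -> koszul_in N p.+2 (koszul_d u) ->
  exists v, koszul_in M p v /\ koszul_in N p.+1 (u - koszul_d v).

Lemma koszul_dD l (u v : koszul l) :
  koszul_d (u + v) = koszul_d u + koszul_d v.
Proof.
elim: l u v => [|x l IH] /= u v; first by rewrite addr0.
rewrite !IH; congr pair.
by rewrite scalerDr opprD addrACA.
Qed.

Lemma koszul_dZ l c (u : koszul l) : koszul_d (c *: u) = c *: koszul_d u.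
Proof.
elim: l u => [|x l IH] /= u; first by rewrite scaler0.
rewrite !IH; congr pair => /=.
by rewrite scalerBr !scalerA mulrC.
Qed.

Lemma koszul_dN l (u : koszul l) : koszul_d (- u) = - koszul_d u.
Proof. by rewrite -scaleN1r koszul_dZ scaleN1r. Qed.

Lemma koszul_dB l (u v : koszul l) :
  koszul_d (u - v) = koszul_d u - koszul_d v.
Proof. by rewrite koszul_dD koszul_dN. Qed.

Lemma koszul_d0 l : koszul_d (0 : koszul l) = 0.
Proof. by rewrite -[0 in LHS](scale0r 0) koszul_dZ scale0r. Qed.

Lemma koszul_dd l (u : koszul l) : koszul_d (koszul_d u) = 0.
Proof.
elim: l u => [|x l IH] //= u; rewrite IH koszul_dB IH koszul_dZ subr0 subrr.
by [].
Qed.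

Lemma koszul_hD l b (u v : koszul l) :
  koszul_h b (u + v) = koszul_h b u + koszul_h b v.
Proof.
elim: l b u v => [|x l IH] b /= u v; first by rewrite addr0.
rewrite !IH; congr pair.
  by rewrite scalerDr addrACA.
by rewrite opprD.
Qed.

Lemma koszul_hZ l b c (u : koszul l) :
  koszul_h b (c *: u) = c *: koszul_h b u.
Proof.
elim: l b u => [|x l IH] b /= u; first by rewrite scaler0.
rewrite !IH; congr pair => /=.
  by rewrite scalerDr !scalerA mulrC.
by rewrite scalerN.
Qed.

Lemma koszul_hN l b (u : koszul l) : koszul_h b (- u) = - koszul_h b u.
Proof. by rewrite -scaleN1r koszul_hZ scaleN1r. Qed.

(** Contraction with [b] is a homotopy from multiplication by the combination of [l] with
    coefficients [b] to zero; hence the ideal generated by [l] kills Koszul cohomology. *)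
Lemma koszul_homotopy l b (u : koszul l) :
  koszul_d (koszul_h b u) + koszul_h b (koszul_d u) =
  (\sum_(0 <= i < size l) b i * l`_i) *: u.
Proof.
elim: l b u => [|x l IH] b /= u.
  by rewrite big_nil scale0r addr0.
case: u => u v /=; rewrite big_nat_recl //=.
have /= IHu := IH (fun i => b i.+1) u; have /= IHv := IH (fun i => b i.+1) v.
rewrite !(koszul_dD, koszul_dZ, koszul_hD, koszul_hZ, koszul_dN, koszul_hN).
congr pair => /=; rewrite scalerDl -?IHu -?IHv.
  rewrite scalerBr scalerA !addrA; congr (_ + _).
  by rewrite [LHS]addrC !addrA addNr add0r addrC.
rewrite scalerDr scalerA opprD !opprK !addrA [x * _]mulrC -!addrA;
  congr (_ + _).
by rewrite addrCA addNKr.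
Qed.

Variable B : A -> Prop.

Lemma koszul_in0 M l p : M 0 -> koszul_in M p (0 : koszul l).
Proof.
move=> M0; elim: l p => [|x l IH] p /=; first by case: ifP.
by split; apply: IH.
Qed.

Lemma koszul_inB M l p (u v : koszul l) : submodule B M ->
  koszul_in M p u -> koszul_in M p v -> koszul_in M p (u - v).
Proof.
move=> hM; elim: l p u v => [|x l IH] p /= u v.
  by case: ifP => _; [case: hM => _ + _; apply|move=> -> ->; rewrite subr0].
by move=> [? ?] [? ?]; split; apply: IH.
Qed.

Lemma koszul_inN M l p (u : koszul l) : submodule B M ->
  koszul_in M p u -> koszul_in M p (- u).
Proof.
move=> hM hu; rewrite -[- u]add0r; apply: koszul_inB => //.
by apply: koszul_in0; case: hM.
Qed.

Lemma koszul_inD M l p (u v : koszul l) : submodule B M ->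
  koszul_in M p u -> koszul_in M p v -> koszul_in M p (u + v).
Proof.
by move=> hM hu hv; rewrite -[v]opprK; apply: koszul_inB => //;
  apply: koszul_inN.
Qed.

Lemma koszul_in_scale M N c l p (u : koszul l) :
  (forall y, M y -> N (c * y)) -> koszul_in M p u -> koszul_in N p (c *: u).
Proof.
move=> hc; elim: l p u => [|x l IH] p /= u.
  by case: ifP => _; [exact: hc|move=> ->; rewrite scaler0].
by move=> [? ?]; split; apply: IH.
Qed.

Lemma koszul_in_sub M N l p (u : koszul l) :
  (forall y, N y -> M y) -> koszul_in N p u -> koszul_in M p u.
Proof.
move=> hNM; elim: l p u => [|x l IH] p /= u; first by case: ifP => _; auto.
by move=> [? ?]; split; apply: IH.
Qed.

Lemma koszul_in_reg M N x l p (u : koszul l) :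
  (forall y, M y -> N (x * y) -> N y) ->
  koszul_in M p u -> koszul_in N p (x *: u) -> koszul_in N p u.
Proof.
move=> hx; elim: l p u => [|z l IH] p /= u; first by case: ifP => _; auto.
by move=> [? ?] [? ?]; split; apply: IH.
Qed.

Lemma koszul_in_add_mul M N x l p (u : koszul l) : N 0 -> M 0 ->
  koszul_in (add_mul N x M) p u ->
  exists v w, [/\ koszul_in N p v, koszul_in M p w & u = v + x *: w].
Proof.
move=> N0 M0; elim: l p u => [|z l IH] p /= u.
  case: ifP => [_ [v [w [Nv Mw ->]]]|_ ->]; first by exists v, w.
  by exists 0, 0; rewrite scaler0 addr0.
case: u => u1 u2 /= [/IH[v1 [w1 [? ? ->]]] /IH[v2 [w2 [? ? ->]]]].
by exists (v1, v2), (w1, w2).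
Qed.

Lemma koszul_in_index0 M l (u : koszul l) : koszul_in M 0 u -> u = 0.
Proof. by elim: l u => [|z l IH] //= [u v] /= [/IH -> /IH ->]. Qed.

Lemma koszul_in_d M l p (u : koszul l) : submodule B M ->
  (forall x, x \in l -> B x) -> koszul_in M p u ->
  koszul_in M p.+1 (koszul_d u).
Proof.
move=> hM; have [M0 _ MZ] := hM.
elim: l p u => [|x l IH] p /= u hl; first by move=> _; case: ifP.
have Bx : B x by apply: hl; rewrite mem_head.
have {}IH : forall p (v : koszul l), koszul_in M p v ->
    koszul_in M p.+1 (koszul_d v).
  by move=> q v; apply: IH => z zl; apply: hl; rewrite inE zl orbT.
move=> [hu1 hu2]; split; first exact: IH.
apply: koszul_inB => //; first by apply: koszul_in_scale hu1 => y; apply: MZ.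
by case: p hu1 hu2 => [_ /koszul_in_index0 ->|p _ /IH //];
  rewrite koszul_d0; apply: koszul_in0.
Qed.

Lemma koszul_in_h M l b p (u : koszul l) : submodule B M ->
  (forall i, B (b i)) -> koszul_in M p u -> koszul_in M p.-1 (koszul_h b u).
Proof.
move=> hM; have [M0 _ MZ] := hM.
elim: l b p u => [|x l IH] b p /= u hb; first by move=> _; case: ifP.
move=> [hu1 hu2]; split; last by apply: koszul_inN => //; apply: IH.
apply: koszul_inD => //; last exact: IH.
by apply: koszul_in_scale hu2 => y; apply: MZ.
Qed.

Lemma koszul_in_bot M l (y : A) : M 0 ->
  koszul_in M 1 (koszul_bot l y) <-> M y.
Proof.
move=> M0; elim: l => //= x l IH; split=> [[/IH //]|/IH hb]; split=> //.
exact: koszul_in0.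
Qed.

Lemma koszul_botZ l c y : koszul_bot l (c * y) = c *: koszul_bot l y.
Proof. by elim: l => //= x l IH; rewrite IH; congr pair; rewrite scaler0. Qed.

Lemma koszul_in_d_bot N l (y : A) : N 0 -> (forall x, x \in l -> N (x * y)) ->
  koszul_in N 2 (koszul_d (koszul_bot l y)).
Proof.
move=> N0; elim: l => //= x l IH hl; split.
  by apply: IH => z zl; apply: hl; rewrite inE zl orbT.
rewrite koszul_d0 subr0 -koszul_botZ; apply/koszul_in_bot => //.
by apply: hl; rewrite mem_head.
Qed.

Lemma koszul_in_top M l (y : A) : M 0 -> M y ->
  koszul_in M (size l).+1 (koszul_top l y).
Proof.
by move=> M0 My; elim: l => //= x l IH; split=> //; apply: koszul_in0.
Qed.

Lemma koszul_topK l y : koszul_topc (koszul_top l y) = y.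
Proof. by elim: l => //= x l IH. Qed.

Lemma koszul_topcB l (u v : koszul l) :
  koszul_topc (u - v) = koszul_topc u - koszul_topc v.
Proof. by elim: l u v => //= x l IH u v; rewrite IH. Qed.

Lemma koszul_topcZ l c (u : koszul l) :
  koszul_topc (c *: u) = c * koszul_topc u.
Proof. by elim: l u => //= x l IH u; rewrite IH. Qed.

Lemma koszul_topc_in M l p (u : koszul l) : M 0 ->
  koszul_in M p u -> M (koszul_topc u).
Proof.
move=> M0; elim: l p u => [|x l IH] p u /=; first by case: ifP => // _ ->.
by move=> [_ /IH].
Qed.

Lemma koszul_topc_d M l p (u : koszul l) : submodule B M ->
  koszul_in M p u -> seq_mul M l (koszul_topc (koszul_d u)).
Proof.
move=> hM; have [M0 _ _] := hM.
elim: l p u => [|x l IH] p u /=; first by move=> _; apply/seq_mul_nil.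
move=> [hu1 /IH hu2]; rewrite koszul_topcB koszul_topcZ.
have [_ sB _] : submodule B (seq_mul M (x :: l)) by apply: submodule_seq_mul.
apply: sB.
  apply/seq_mulP => //.
  exists (fun i => if i is 0 then koszul_topc u.1 else 0); split.
    by case=> [|i] //; apply: (koszul_topc_in M0 hu1).
  by rewrite /= big_nat_recl //= big1 ?addr0 // => i _; rewrite mulr0.
case/(seq_mulP _ _ M0): hu2 => w [Mw ->]; apply/seq_mulP => //.
exists (fun i => if i is j.+1 then w j else 0); split; first by case.
by rewrite /= big_nat_recl //= mulr0 add0r.
Qed.

(** Degree 0 cohomology consists of the elements of M/N killed by [l]: the differential of a degree
    0 cochain [y] lists the products [x * y]. *)
Lemma exact_mod_bot M N l y : M 0 -> N 0 -> exact_mod M N l 0 ->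
  M y -> (forall x, x \in l -> N (x * y)) -> N y.
Proof.
move=> M0 N0 ex My hy; have [||v []] := ex (koszul_bot l y).
- exact/koszul_in_bot.
- exact: koszul_in_d_bot.
- by move=> /koszul_in_index0 ->;
  rewrite koszul_d0 subr0 => /(koszul_in_bot _ _ N0).
Qed.

(** Top degree cohomology is M/lM: every top cochain is a cocycle, and the boundaries are those with
    coefficient in lM. *)
Lemma exact_mod_top M l : submodule B M -> exact_mod M (eq^~ 0) l (size l) ->
  forall y, M y -> seq_mul M l y.
Proof.
move=> hM ex y My; have [M0 _ _] := hM.
have [||v [Mv /(koszul_topc_in (M := eq^~ 0) erefl)]] := ex (koszul_top l y).
- exact: koszul_in_top.
- suff -> : koszul_d (koszul_top l y) = 0 by apply: koszul_in0.
  elim: l {ex} => //= x l IH; rewrite IH koszul_d0 scaler0 subr0.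
  by [].
by rewrite koszul_topcB koszul_topK => /subr0_eq ->;
  apply: (koszul_topc_d hM Mv).
Qed.

End Koszul.

(** * Lengths of regular sequences *)

Section Grade.
Variables (A : comNzRingType) (B M : A -> Prop) (a : seq A).
Hypotheses (hM : submodule B M) (aB : forall x, x \in a -> B x).
Implicit Types (N : A -> Prop) (f : seq A).

(** Coefficients are confined to [B], so this is the ideal generated by [a] in the base ring and not
    in the larger ring [A]. *)
Definition combination (x : A) : Prop :=
  exists b : nat -> A,
    (forall i, B (b i)) /\ x = \sum_(0 <= i < size a) b i * a`_i.

Definition exact_below N k : Prop :=
  forall p, (p < k)%N -> exact_mod M N a p.

Lemma combination_stable N x y :
  submodule B N -> combination x -> N y -> N (x * y).
Proof.
move=> hN [b [Bb ->]] Ny; rewrite mulr_suml big_seq_cond.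
rewrite -big_seq_cond big_mkord; apply: (submodule_sum _ hN) => i.
have [_ _ NZ] := hN; rewrite -mulrA; apply: (NZ) => //; apply: NZ => //.
by apply: aB; apply: mem_nth.
Qed.

(** A diagram chase in the long exact sequence of 0 -> M/N -> M/N -> M/(N + xM) -> 0, whose first
    map is multiplication by [x]. *)
Lemma exact_mod_regular N x p : submodule B N -> combination x ->
  (forall y, M y -> N (x * y) -> N y) ->
  exact_mod M N a p -> exact_mod M N a p.+1 ->
  exact_mod M (add_mul N x M) a p.
Proof.
move=> hN hx reg ex0 ex1 u Mu hdu.
have [N0 _ NZ] := hN; have [M0 _ MZ] := hM.
have [n [w [Nn Mw duE]]] := koszul_in_add_mul N0 M0 hdu.
(* Applying the differential to [d u = n + x w] gives [x d w = - d n], which lies in N; regularity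
   cancels [x]. *)
have hdw : koszul_in N p.+3 (koszul_d w).
  apply: (koszul_in_reg reg); first exact: (koszul_in_d hM).
  rewrite -koszul_dZ -(addKr n (x *: w)) -duE koszul_dD koszul_dN koszul_dd.
  by rewrite addr0; apply: (koszul_inN hN); apply: (koszul_in_d hN).
have [v [Mv hwv]] := ex1 w Mw hdw.
have xMM y : M y -> M (x * y) by apply: combination_stable.
have hxN y : N y -> N (x * y) by apply: combination_stable.
have Mxv : koszul_in M p.+1 (u - x *: v).
  by apply: (koszul_inB hM) => //; apply: koszul_in_scale Mv.
have [|v' [Mv' hv']] := ex0 (u - x *: v) Mxv.
  rewrite koszul_dB koszul_dZ duE -addrA -scalerBr.
  by apply: (koszul_inD hN) => //; apply: koszul_in_scale hwv.
exists v'; split=> //.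
have -> : u - koszul_d v' = (u - x *: v - koszul_d v') + x *: v.
  by rewrite addrAC subrK.
apply: (koszul_inD (submodule_add_mul x hN hM)).
- by apply: koszul_in_sub hv' => y Ny; exists y, 0; rewrite mulr0 addr0.
- by apply: koszul_in_scale Mv => y My; exists 0, y; rewrite add0r.
Qed.

Lemma koszul_dh_eq N x p (u : koszul a) : submodule B N -> combination x ->
  koszul_in M p.+1 u -> koszul_in N p.+2 (koszul_d u) ->
  exists v n, [/\ koszul_in M p v, koszul_in N p.+1 n
                & x *: u = koszul_d v + n].
Proof.
move=> hN [b [Bb xE]] Mu Ndu; exists (koszul_h b u), (koszul_h b (koszul_d u)).
split; [exact: (koszul_in_h hM Bb Mu)|exact: (koszul_in_h hN Bb Ndu)|].
by rewrite koszul_homotopy xE.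
Qed.

Lemma exact_mod0_regular N x : submodule B N -> combination x ->
  (forall y, M y -> N (x * y) -> N y) -> exact_mod M N a 0.
Proof.
move=> hN hx reg u Mu Ndu; have [M0 _ _] := hM.
exists 0; split; first exact: koszul_in0.
have [v [n [/koszul_in_index0 -> Nn xuE]]] := koszul_dh_eq hN hx Mu Ndu.
rewrite koszul_d0 subr0; apply: (koszul_in_reg reg) => //.
by rewrite xuE koszul_d0 add0r.
Qed.

(** By the homotopy, [x] acts as zero on the cohomology of M/N, so the connecting map from degree
    [p] of M/(N + xM) to degree [p.+1] of M/N is surjective. *)
Lemma exact_modS_regular N x p : submodule B N -> combination x ->
  (forall y, M y -> N (x * y) -> N y) ->
  exact_mod M (add_mul N x M) a p -> exact_mod M N a p.+1.
Proof.
move=> hN hx reg ex u Mu Ndu; have [N0 _ _] := hN; have [M0 _ _] := hM.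
have [v [n [Mv Nn xuE]]] := koszul_dh_eq hN hx Mu Ndu.
(* Modulo N the differential of [v] is [x u], so [v] is a cocycle modulo N + xM whose image under
   the connecting map is the class of [u]. *)
have [|w [Mw]] := ex v Mv.
  rewrite -[koszul_d v](addrK n) -xuE addrC;
    apply: (koszul_inD (submodule_add_mul x hN hM)).
  - apply: koszul_in_sub (koszul_inN hN Nn) => y Ny.
    by exists y, 0; rewrite mulr0 addr0.
  - by apply: koszul_in_scale Mu => y My; exists 0, y; rewrite add0r.
case/(koszul_in_add_mul N0 M0) => n' [z [Nn' Mz vwE]].
exists z; split=> //; apply: (koszul_in_reg reg).
  by apply: (koszul_inB hM) => //; apply: (koszul_in_d hM).
rewrite scalerBr xuE -[v](subrK (koszul_d w)) vwE !(koszul_dD, koszul_dZ).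
rewrite koszul_dd addr0 addrAC addrK.
by apply: (koszul_inD hN) => //; apply: (koszul_in_d hN).
Qed.

Lemma exact_below_step N x k : submodule B N -> combination x ->
  (forall y, M y -> N (x * y) -> N y) ->
  exact_below N k.+1 <-> exact_below (add_mul N x M) k.
Proof.
move=> hN hx reg; split=> ex p ltp.
  by apply: exact_mod_regular => //; apply: ex => //; apply: ltnW.
case: p ltp => [_|p ltp]; first exact: exact_mod0_regular hx reg.
by apply: exact_modS_regular reg _ => //; apply: ex.
Qed.

Lemma exact_below_regular f k : (forall x, x \in f -> combination x) ->
  regular_seq M f ->
  exact_below (eq^~ 0) (size f + k) <-> exact_below (seq_mul M f) k.
Proof.
move=> hf [reg _]; have [M0 _ _] := hM.
have -> : eq^~ 0 = seq_mul M (take 0 f).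
  by apply/funext => y; apply/propext; rewrite take0 seq_mul_nil.
rewrite -[in seq_mul M f](take_size f).
have : (size f <= size f)%N by [].
move: {1 3 4}(size f) => j; elim: j k => [|j IH] k ltj //.
rewrite addSnnS IH 1?ltnW // (take_nth 0) // seq_mul_rcons //.
apply: exact_below_step; first exact: submodule_seq_mul.
- by apply: hf; apply: mem_nth.
- by move=> y; apply: reg.
Qed.

(** Regularity of [g] forces vanishing in all degrees below [size g]. If [f] were shorter, degree 0
    cohomology of M/fM would vanish, but [y] represents a nonzero class there. *)
Lemma regular_size_le f g y :
  (forall x, x \in f -> combination x) -> regular_seq M f ->
  M y -> ~ seq_mul M f y -> (forall x, x \in a -> seq_mul M f (x * y)) ->
  (forall x, x \in g -> combination x) -> regular_seq M g ->
  (size g <= size f)%N.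
Proof.
move=> hf regf My nfy socle hg regg; rewrite leqNgt; apply/negP => ltfg.
have hMf := submodule_seq_mul f hM; have [N0 _ _] := hMf.
have [M0 _ _] := hM.
apply: nfy; apply: (exact_mod_bot M0 N0 _ My socle).
have [+ _] := exact_below_regular 1 hf regf; apply=> // p.
rewrite addn1 ltnS => lep.
have [_] := exact_below_regular 0 hg regg; apply=> //.
by rewrite addn0; apply: leq_ltn_trans lep ltfg.
Qed.

(** A regular sequence longer than [a] would kill even the top cohomology M/aM. This bound is what
    makes maximal lengths exist. *)
Lemma regular_size_le_gens g y : M y -> ~ seq_mul M a y ->
  (forall x, x \in g -> combination x) -> regular_seq M g ->
  (size g <= size a)%N.
Proof.
move=> My nay hg regg; rewrite leqNgt; apply/negP => ltag.
apply: nay; apply: (exact_mod_top hM _ My).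
by have [_] := exact_below_regular 0 hg regg; apply=> //; rewrite addn0.
Qed.

End Grade.

Lemma combination_sub (A : comNzRingType) (B B' : A -> Prop) l x :
  (forall b, B b -> B' b) -> combination B l x -> combination B' l x.
Proof. by move=> BB' [b [Bb ->]]; exists b; split=> // i; apply: BB'. Qed.

Lemma seq_mul_combination (A : comNzRingType) (B M : A -> Prop) l f y :
  submodule B M -> (forall x, x \in f -> combination B l x) ->
  seq_mul M f y -> seq_mul M l y.
Proof.
move=> hM hf [u [Mu ->]]; have hl := submodule_seq_mul l hM.
have [M0 _ MZ] := hM.
apply: (submodule_sum _ hl) => i; have [|b [Bb ->]] := hf f`_i;
  first exact: mem_nth.
apply/seq_mulP => //; exists (fun j => b j * u i).
split; first by move=> j; apply: MZ.
by rewrite mulr_suml; apply: eq_bigr => j _; rewrite mulrAC mulrC.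
Qed.

Lemma bounded_max (L : nat -> Prop) k0 b :
  L k0 -> (forall k, L k -> (k <= b)%N) -> exists k, is_max L k.
Proof.
move=> Lk0 Lb; have ex : exists k, `[< L k >] by exists k0; apply/asboolP.
have bound k : `[< L k >] -> (k <= b)%N by move/asboolP; apply: Lb.
have [k /asboolP Lk kmax] := ex_maxnP ex bound.
by exists k; split=> // l Ll; apply/kmax/asboolP.
Qed.

(** * Noetherian rings and prime avoidance *)

Section Noetherian.
Variable A : comNzRingType.
Implicit Types (P Q J m : A -> Prop).

Local Notation ideal := (submodule (fun=> True)).

(** The ascending chain condition along initial segments of a sequence; it is refuted directly by a
    sequence in which each term avoids the ideal of its predecessors. *)
Definition noetherian : Prop :=
  forall f : nat -> A, exists n, seq_mul (fun=> True) (mkseq f n) (f n).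

Lemma seq_mul_ideal J (l : seq A) y :
  ideal J -> (forall x, x \in l -> J x) -> seq_mul (fun=> True) l y -> J y.
Proof.
move=> hJ hl [u [_ ->]]; apply: (submodule_sum _ hJ) => i; rewrite mulrC.
by have [_ _ JZ] := hJ; apply: JZ => //; apply: hl; apply: mem_nth.
Qed.

Lemma mem_seq_mul (l : seq A) x : x \in l -> seq_mul (fun=> True) l x.
Proof.
move=> xl; exists (fun i => (i == index x l :> nat)%:R); split=> //.
have ltx : (index x l < size l)%N by rewrite index_mem.
rewrite (bigD1 (Ordinal ltx)) //= eqxx mulr1 nth_index // big1 ?addr0 // => i.
by rewrite -val_eqE /= => /negbTE ->; rewrite mulr0.
Qed.

Lemma dependent_sequence P (D : seq A -> A -> Prop) :
  (forall l, (forall x, x \in l -> P x) -> exists2 y, P y & D l y) ->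
  exists f : nat -> A, forall n, P (f n) /\ D (mkseq f n) (f n).
Proof.
move=> step.
have step' (l : seq A) : exists y, (forall x, x \in l -> P x) -> P y /\ D l y.
  have [/step[y]|nl] := pselect (forall x, x \in l -> P x); first by exists y.
  (* The value 0 is a placeholder for lists with an entry outside [P]. *)
  by exists 0 => /nl.
have [g hg] := choice step'.
pose L n := iter n (fun l => rcons l (g l)) [::].
have LE n : mkseq (fun n => g (L n)) n = L n.
  by elim: n => //= n IH; rewrite mkseqS IH.
have LP n x : x \in L n -> P x.
  elim: n x => // n IH x /=; rewrite mem_rcons inE => /orP[/eqP ->|/IH //].
  by have [] := hg _ IH.
by exists (fun n => g (L n)) => n; rewrite LE; apply: hg (LP n).
Qed.

Lemma noetherian_finite_subset P : noetherian ->
  exists l : seq A,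
    (forall x, x \in l -> P x) /\ forall y, P y -> seq_mul (fun=> True) l y.
Proof.
move=> noeth; apply: contrapT => nfin.
have [|f hf] := @dependent_sequence P (fun l y => ~ seq_mul (fun=> True) l y).
  move=> l hl; apply: contrapT => nex; apply: nfin; exists l; split=> // y Py.
  by apply: contrapT => ny; apply: nex; exists y.
by have [n] := noeth f; have [] := hf n.
Qed.

Lemma noetherian_maximal (T : Type) (J : T -> A -> Prop) (P : T -> Prop) t0 :
  noetherian -> (forall t, ideal (J t)) -> P t0 ->
  exists2 t, P t & forall t', P t' ->
    (forall x, J t x -> J t' x) -> forall x, J t' x -> J t x.
Proof.
move=> noeth hJ Pt0; apply: contrapT => nmax.
(* Each enlargement comes with an element witnessing that it is strict; the sequence of these
   witnesses contradicts the chain condition. *)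
have step t : exists tx : T * A, P t ->
    [/\ P tx.1, forall x, J t x -> J tx.1 x, J tx.1 tx.2 & ~ J t tx.2].
  apply: contrapT => /forallNP nex; apply: nmax; exists t.
    by apply: contrapT => nPt; apply: (nex (t, 0)).
  move=> t' Pt' le x Jx; apply: contrapT => nJx.
  by apply: (nex (t', x)) => _; split.
have [g hg] := choice step.
pose Y n := iter n (fun t => (g t).1) t0.
have YP n : P (Y n) by elim: n => //= n /hg[].
have Yle n k x : J (Y n) x -> J (Y (n + k)%N) x.
  by elim: k => [|k IH] Jx; rewrite ?addn0 // addnS;
    have [_ + _ _] := hg _ (YP (n + k)%N);
    apply; apply: IH.
have [n hn] := noeth (fun n => (g (Y n)).2).
have [_ _ _] := hg _ (YP n); apply; apply: seq_mul_ideal hn => // x /mapP[k].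
rewrite mem_iota add0n => /andP[_ ltkn] ->; rewrite -(subnKC ltkn); apply: Yle.
by have [] := hg _ (YP k).
Qed.

(** Only closure of [m] under sums and products enters, so the lemma applies to the image in P of
    the irrelevant ideal of R. *)
Lemma prime_avoidance (T : eqType) (p : T -> A -> Prop) (l : seq T) m :
  (forall t, t \in l -> ideal (p t)) ->
  (forall t, t \in l -> forall x y, p t (x * y) -> p t x \/ p t y) ->
  (forall x y, m x -> m y -> m (x + y)) ->
  (forall x y, m x -> m y -> m (x * y)) ->
  (exists x, m x) ->
  (forall t, t \in l -> exists2 x, m x & ~ p t x) ->
  exists2 x, m x & forall t, t \in l -> ~ p t x.
Proof.
move=> + + mD mM [x0 mx0]; have [n] := ubnP (size l).
elim: n l => // n IH [|t l] /= szl hp pp hm; first by exists x0.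
have sub u : u \in l -> u \in t :: l by rewrite inE orbC => ->.
have [[u ul ule]|nle] := pselect
    (exists2 u, u \in l & forall x, m x -> p u x -> p t x).
  have sub' v : v \in t :: rem u l -> v \in t :: l.
    by rewrite !inE => /orP[->|/mem_rem ->] //; rewrite orbT.
  have [||||x mx hx] := IH (t :: rem u l).
  - by rewrite /= size_rem // prednK //; case: (l) ul.
  - by move=> v /sub'; apply: hp.
  - by move=> v /sub'; apply: pp.
  - by move=> v /sub'; apply: hm.
  exists x => // v; rewrite inE => /orP[/eqP ->|vl];
    first exact: hx (mem_head _ _).
  have [->|neq] := eqVneq v u.
    by move=> /(ule _ mx); apply: hx (mem_head _ _).
  apply: hx; rewrite inE; apply/orP; right; move: vl.
  by rewrite (perm_mem (perm_to_rem ul)) inE (negbTE neq).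
have [||||z mz hz] := IH l; rewrite //.
- by move=> u /sub; apply: hp.
- by move=> u /sub; apply: pp.
- by move=> u /sub; apply: hm.
have [ptz|nptz] := pselect (p t z); last first.
  by exists z => // u; rewrite inE => /orP[/eqP ->|/hz].
have tl : t \in t :: l by rewrite mem_head.
(* [w] is a product of elements of the various [p u] lying outside [p t]. If [z] avoids all of [l]
   but falls into [p t], then [z + w] avoids everything. *)
have [w [mw nptw wl]] :
    exists w, [/\ m w, ~ p t w & forall u, u \in l -> p u w].
  have : forall u, u \in l -> exists2 x, m x & p u x /\ ~ p t x.
    move=> u ul; apply: contrapT => nex; apply: nle; exists u => // x mx pux.
    by apply: contrapT => nptx; apply: nex; exists x.
  have {sub} : {subset l <= t :: l} := sub.
  elim: {1 3 4}l => [|u l' IHl] sub hl.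
    by have [w mw nptw] := hm t tl; exists w.
  have ul : u \in u :: l' by rewrite mem_head.
  have sub' v : v \in l' -> v \in u :: l' by rewrite inE orbC => ->.
  have [||w [mw nptw wl']] := IHl; first by move=> v /sub' /sub.
    by move=> v /sub'; apply: hl.
  have [x mx [pux nptx]] := hl u ul.
  exists (w * x); split; first exact: mM.
    by move=> /(pp t tl)[].
  move=> v; rewrite inE => /orP[/eqP ->|vl].
    by have [_ _ pZ] := hp u (sub _ ul); apply: pZ.
  by have [_ _ pZ] := hp v (sub _ (sub' _ vl)); rewrite mulrC; apply: pZ => //;
    apply: wl'.
exists (z + w); first exact: mD.
move=> u; rewrite inE => /orP[/eqP ->|ul] pzw.
  by apply: nptw; have [_ pB _] := hp t tl; rewrite -(addKr z w) addrC;
    apply: pB.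
by apply: (hz u ul); have [_ pB _] := hp u (sub _ ul); rewrite -(addrK w z);
  apply: pB => //; apply: wl.
Qed.

(* Zero divisors modulo Q lie in annihilators Q : y which are maximal among all
   such annihilators; these are prime, and finitely many of them suffice. *)
Lemma zero_divisors_socle Q m : noetherian -> ideal Q ->
  (forall x y, m x -> m y -> m (x + y)) ->
  (forall x y, m x -> m y -> m (x * y)) ->
  (exists x, m x) ->
  (forall x, m x -> exists y, ~ Q y /\ Q (x * y)) ->
  exists y, ~ Q y /\ forall x, m x -> Q (x * y).
Proof.
move=> noeth hQ mD mM mex zd; have [Q0 QB QZ] := hQ.
pose ann y x := Q (x * y).
have ann_ideal y : ideal (ann y).
  split; rewrite /ann; first by rewrite mul0r.
    by move=> x z Qx Qz; rewrite mulrBl; apply: QB.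
  by move=> b x _ Qx; rewrite -mulrA; apply: QZ.
pose max y := ~ Q y /\ forall y', ~ Q y' ->
  (forall x, ann y x -> ann y' x) -> forall x, ann y' x -> ann y x.
have maxP x y : ~ Q y -> Q (x * y) -> exists2 y', max y' & ann y' x.
  move=> nQy Qxy.
  have [|y' [nQy' ay'] my'] := @noetherian_maximal _ ann
    (fun y => ~ Q y /\ ann y x) y noeth ann_ideal; first by split.
  by exists y' => //; split=> // z nQz le; apply: my' => //; split=> //;
    apply: le.
have prime y x z : max y -> ann y (x * z) -> ann y x \/ ann y z.
  move=> [nQy my] axz; have [?|naz] := pselect (ann y z); [by right|left].
  apply: (my (z * y)) => //; last by rewrite /ann mulrA.
  by move=> w aw; rewrite /ann mulrCA; apply: QZ.
have [l [lmax hl]] := noetherian_finite_subset max noeth.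
apply: contrapT => nsoc.
have [||||||x mx hx] := @prime_avoidance _ ann l m; rewrite //.
- by move=> y yl x z; apply: prime; apply: lmax.
- move=> y yl; apply: contrapT => nex; apply: nsoc; exists y.
  split; first by have [] := lmax y yl.
  by move=> x mx; apply: contrapT => nQ; apply: nex; exists x.
have [y [nQy Qxy]] := zd x mx; have [y' my' ay'] := maxP x y nQy Qxy.
(* Otherwise, by primality, a product of elements taken from each [ann u] stays outside [ann y'].
   That product sends all of [l] into Q, hence also [y'], which lies in the ideal generated by
   [l]. *)
have [u ul au] : exists2 u, u \in l & forall z, ann u z -> ann y' z.
  apply: contrapT => nex.
  have : exists2 w, ~ ann y' w & forall u, u \in l -> ann u w.
    have {}nex u : u \in l -> exists2 z, ann u z & ~ ann y' z.
      move=> ul; apply: contrapT => nz; apply: nex; exists u => // z az.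
      by apply: contrapT => naz; apply: nz; exists z.
    elim: (l) nex => [|u l' IH] nex.
      by exists 1 => //; rewrite /ann mul1r; case: my'.
    have [v ul'|w nw aw] := IH; first by apply: nex; rewrite inE ul' orbT.
    have [z az naz] := nex u (mem_head _ _).
    exists (w * z) => [/(prime _ _ _ my')[]//|v].
    rewrite inE => /orP[/eqP ->|vl']; rewrite /ann.
      by rewrite -mulrA; apply: QZ.
    by rewrite mulrAC mulrC; apply: QZ => //; apply: aw.
  move=> [w naw aw]; apply: naw.
  have := hl _ my'; rewrite /ann => -[c [_ ->]]; rewrite mulr_sumr.
  apply: (submodule_sum _ hQ) => i; rewrite mulrA [_ * c i]mulrC;
    apply: QZ => //.
  by apply: aw; apply: mem_nth.
have [nQu umax] := lmax u ul.
by apply: (hx u ul); apply: (umax y') => //; case: my'.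
Qed.

End Noetherian.

(** * Hilbert's basis theorem *)

(** Always jump to a position where the remaining tail attains its minimum. *)
Lemma nat_nondecreasing_subsequence (f : nat -> nat) : exists e : nat -> nat,
  (forall i j, (i < j)%N -> (e i < e j)%N) /\
  forall i j, (i < j)%N -> (f (e i) <= f (e j))%N.
Proof.
have tail_min n :
    exists k, (n <= k)%N /\ forall j, (n <= j)%N -> (f k <= f j)%N.
  have ex : exists v, `[< exists2 k, (n <= k)%N & f k = v >].
    by exists (f n); apply/asboolP; exists n.
  have [_ /asboolP[k lenk <-] kmin] := ex_minnP ex.
  by exists k; split=> // j lenj; apply: kmin; apply/asboolP; exists j.
have [g hg] := choice tail_min.
pose e := fix e i := if i is i'.+1 then g (e i').+1 else g 0%N.
have e_lt i j : (i < j)%N -> (e i < e j)%N.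
  apply: (homo_ltn ltn_trans) => {}i /=.
  by have [] := hg (e i).+1.
exists e; split=> // i j /e_lt ltij.
by case: i ltij => [|i] ltij; [have [_] := hg 0%N|have [le] := hg (e i).+1];
  apply=> //; apply: leq_trans (ltnW ltij).
Qed.

(** Successive subsequences are extracted, one coordinate at a time, until all exponents are
    nondecreasing. *)
Lemma dickson n (m : nat -> 'X_{1..n}) :
  exists i j, (i < j)%N /\ (m i <= m j)%MM.
Proof.
suff [e [e_lt em]] : exists e : nat -> nat,
    (forall i j, (i < j)%N -> (e i < e j)%N) /\
    forall i j, (i < j)%N -> forall k, k \in enum 'I_n ->
      (m (e i) k <= m (e j) k)%N.
  exists (e 0%N), (e 1%N); split; first exact: e_lt.
  by apply/mnm_lepP => k; apply: em => //; rewrite mem_enum.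
elim: (enum 'I_n) => [|k l [e [e_lt em]]]; first by exists id.
have [e' [e'_lt em']] := nat_nondecreasing_subsequence (fun i => m (e i) k).
exists (e \o e'); split=> [i j ltij|i j ltij k']; first exact/e_lt/e'_lt.
rewrite inE => /orP[/eqP ->|k'l]; first exact: em'.
by apply: em => //; apply: e'_lt.
Qed.

Lemma mlead_cancel_lt n (K : fieldType) (p q : mpoly n K) : q != 0 ->
  (mlead q <= mlead p)%MM -> p != 0 ->
  let r := p - (mleadc p / mleadc q) *: 'X_[mlead p - mlead q] * q in
  r != 0 -> (mlead r < mlead p)%O.
Proof.
move=> q0 le p0 r r0.
have lc0 : mleadc q != 0 by rewrite mleadc_eq0.
have lq : mlead ((mleadc p / mleadc q) *: 'X_[mlead p - mlead q] * q) = mlead p.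
  rewrite -scalerAl mleadZ ?mulf_neq0 ?invr_neq0 ?mleadc_eq0 //.
  by rewrite mleadM ?mleadXm ?submK // -mleadc_eq0 mleadXm mcoeffX eqxx
    oner_eq0.
have ler : (mlead r <= mlead p)%O.
  by apply: le_trans (mleadB_le _ _) _; rewrite lq joinxx.
rewrite lt_neqAle ler andbT; apply: contraNneq r0 => lrp.
rewrite -mleadc_eq0 lrp /r mcoeffB -scalerAl mcoeffZ.
have -> : ('X_[mlead p - mlead q] * q)@_(mlead p) = mleadc q.
  by rewrite mulrC -{1}(submK le) mcoeffMX.
by rewrite divfK ?subrr.
Qed.

(** If J were not finitely generated, one could keep choosing an element of J outside the ideal of
    its predecessors with least leading monomial. By Dickson some leading monomial divides a later
    one, and cancelling leading terms contradicts that minimality. *)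
Lemma mpoly_noetherian n (K : fieldType) : noetherian (mpoly n K).
Proof.
move=> f; apply: contrapT => /forallNP nf.
pose J y := exists k, seq_mul (fun=> True) (mkseq f k) y.
have subT k : submodule (fun=> True) (seq_mul (fun=> True) (mkseq f k)).
  exact: submodule_seq_mul.
have J_le k k' y : (k <= k')%N -> seq_mul (fun=> True) (mkseq f k) y ->
    seq_mul (fun=> True) (mkseq f k') y.
  move=> lek; apply: seq_mul_ideal => // x xk; apply: mem_seq_mul.
  have/mapP[i] := xk; rewrite mem_iota add0n => ltik ->.
  by apply: map_f; rewrite mem_iota add0n (leq_trans ltik).
have hJ : submodule (fun=> True) J.
  split=> [|x y [k hx] [k' hy]|b x _ [k hx]].
  - by exists 0%N; case: (subT 0%N).
  - exists (maxn k k'); have [_ sB _] := subT (maxn k k').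
    by apply: sB; [apply: J_le _ hx|apply: J_le _ hy];
      rewrite ?leq_maxl ?leq_maxr.
  - by exists k; have [_ _] := subT k; apply.
pose D l (y : mpoly n K) := ~ seq_mul (fun=> True) l y /\
  forall z, J z -> ~ seq_mul (fun=> True) l z -> ~ (mlead z < mlead y)%O.
have [l hl|p hp] := @dependent_sequence _ J D.
  (* A finite list from J already lies in one stage of the chain, so [f N] is a candidate outside
     its ideal; well-foundedness of the monomial order then yields a least candidate. *)
  have [N hN] : exists N,
      forall x, x \in l -> seq_mul (fun=> True) (mkseq f N) x.
    elim: l hl => [|x l IH] hl; first by exists 0%N.
    have [y yl|N hN] := IH; first by apply: hl; rewrite inE yl orbT.
    have [k hk] := hl x (mem_head _ _); exists (maxn k N) => y.
    by rewrite inE => /orP[/eqP ->|/hN hy]; [apply: J_le _ hk|apply: J_le _ hy];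
      rewrite ?leq_maxl ?leq_maxr.
  have nfN : ~ seq_mul (fun=> True) l (f N).
    by move=> /(seq_mul_ideal (subT N) hN); apply: nf.
  have JfN : J (f N).
    by exists N.+1; apply: mem_seq_mul; apply: map_f;
      rewrite mem_iota add0n ltnS leqnn.
  apply: contrapT => nex.
  suff min mm y : mlead y = mm -> ~ seq_mul (fun=> True) l y -> ~ J y.
    exact: min nfN JfN.
  elim/(well_founded_ind (@ltom_wf n)): mm y => mm IH y my ny Jy.
  apply: nex; exists y => //; split=> // z Jz nz; rewrite my => ltz.
  exact: IH ltz z erefl nz Jz.
have p0 i : p i != 0.
  apply/eqP => pi0; have [_ [np _]] := hp i; apply: np; rewrite pi0.
  by exists (fun=> 0); split=> //; rewrite big1 // => k _; rewrite mulr0.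
have [i [j [ltij leij]]] := dickson (fun i => mlead (p i)).
have [Jj [nj minj]] := hp j; have [Ji _] := hp i.
have [_ sB sZ] : submodule (fun=> True) (seq_mul (fun=> True) (mkseq p j)).
  exact: submodule_seq_mul.
set c := (mleadc (p j) / mleadc (p i)) *: 'X_[mlead (p j) - mlead (p i)].
have cpi : seq_mul (fun=> True) (mkseq p j) (c * p i).
  by apply: sZ => //; apply: mem_seq_mul; apply: map_f; rewrite mem_iota.
have nr : ~ seq_mul (fun=> True) (mkseq p j) (p j - c * p i).
  move=> hr; apply: nj; rewrite -(subrK (c * p i) (p j)).
  by apply: (submoduleD (B := fun=> True)) => //; apply: submodule_seq_mul.
apply: (minj (p j - c * p i)) => //; last first.
  apply: mlead_cancel_lt => //; apply/eqP => r0; apply: nr; rewrite r0.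
  by have := sZ 0 _ I cpi; rewrite mul0r.
by have [_ JB JZ] := hJ; apply: JB => //; apply: JZ.
Qed.

(** * Localized submodules *)

Lemma divrB_common (F : fieldType) (x y s t : F) : s != 0 -> t != 0 ->
  x / s - y / t = (t * x - s * y) / (s * t).
Proof. by move=> s0 t0; field; rewrite s0 t0. Qed.

Lemma divrD_common (F : fieldType) (x y z s t : F) : s != 0 -> t != 0 ->
  x / s + z * (y / t) = (t * x + z * (s * y)) / (s * t).
Proof. by move=> s0 t0; field; rewrite s0 t0. Qed.

Section Localization.
Variables (R : comNzRingType) (A : idomainType) (h : {rmorphism R -> A}).
Variable m : R -> Prop.
Hypotheses (m1 : ~ m 1) (mM : forall s t, ~ m s -> ~ m t -> ~ m (s * t)).
Hypothesis h_neq0 : forall t, ~ m t -> h t != 0.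
Implicit Types M : A -> Prop.

Definition image (x : A) : Prop := exists a, x = h a.

Local Notation loc := (localization h m).

Lemma tofrac_neq0 t : ~ m t -> tofrac (h t) != 0.
Proof. by move=> /h_neq0; rewrite tofrac_eq0. Qed.

Lemma localization_tofrac M x : M x -> loc M (tofrac x).
Proof. by exists x, 1; rewrite !rmorph1 divr1. Qed.

Lemma localization_tofracE M x : submodule image M ->
  loc M (tofrac x) <-> exists2 t, ~ m t & M (h t * x).
Proof.
move=> [_ _ MZ]; split=> [[y [t [My nt e]]]|[t nt Mx]].
  exists t => //; rewrite mulrC; suff -> : x * h t = y by [].
  by apply/eqP; rewrite -tofrac_eq tofracM e divfK ?tofrac_neq0.
by exists (h t * x), t; split=> //;
  rewrite tofracM mulrAC divff ?mul1r ?tofrac_neq0.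
Qed.

Lemma submodule_localization M : submodule image M ->
  submodule (loc image) (loc M).
Proof.
move=> [M0 MB MZ]; split.
- by rewrite -tofrac0; apply: localization_tofrac.
- move=> _ _ [x [s [Mx ns ->]]] [y [t [My nt ->]]].
  exists (h t * x - h s * y), (s * t); split; last 1 first.
  + by rewrite rmorphM tofracB !tofracM divrB_common ?tofrac_neq0.
  + by apply: MB; apply: MZ => //; eexists.
  + exact: mM.
- move=> _ _ [_ [s [[b ->] ns ->]]] [y [t [My nt ->]]].
  exists (h b * y), (s * t); split; [by apply: MZ => //; exists b|exact: mM|].
  by rewrite rmorphM !tofracM mulf_div.
Qed.

Lemma seq_mul_localization M (f : seq A) : submodule image M ->
  seq_mul (loc M) (map (@tofrac A) f) = loc (seq_mul M f).
Proof.
move=> hM; have hLM := submodule_localization hM.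
have [M0 MB MZ] := hM; have [LM0 _ _] := hLM.
elim/last_ind: f => [|f x IH].
  apply/funext => y; apply/propext; rewrite seq_mul_nil; split=> [->|].
    by rewrite -tofrac0; apply: localization_tofrac; apply/seq_mul_nil.
  by move=> [_ [t [/seq_mul_nil -> _ ->]]]; rewrite tofrac0 mul0r.
have [_ NB NZ] := submodule_seq_mul f hM.
rewrite map_rcons !seq_mul_rcons // IH.
apply/funext => y; apply/propext; split.
  move=> [_ [_ [[u [s [Nu ns ->]]] [v [t [Mv nt ->]]] ->]]].
  exists (h t * u + x * (h s * v)), (s * t); split; last 1 first.
  - by rewrite rmorphM tofracD !tofracM divrD_common ?tofrac_neq0.
  - exists (h t * u), (h s * v).
    by split=> //; [apply: NZ => //; exists t|apply: MZ => //; exists s].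
  - exact: mM.
move=> [_ [t [[u [v [Nu Mv ->]]] nt ->]]].
exists (tofrac u / tofrac (h t)), (tofrac v / tofrac (h t)); split.
- by exists u, t.
- by exists v, t.
- by rewrite tofracD tofracM mulrDl mulrA.
Qed.

Lemma regular_seq_localization M (f : seq A) : submodule image M ->
  (forall i, (i < size f)%N -> forall y, M y ->
     seq_mul M (take i f) (f`_i * y) -> seq_mul M (take i f) y) ->
  (exists y, loc M y /\ ~ loc (seq_mul M f) y) ->
  regular_seq (loc M) (map (@tofrac A) f).
Proof.
move=> hM reg ex; split; last by rewrite seq_mul_localization.
have [M0 MB MZ] := hM.
move=> i; rewrite size_map => lti _ [y [t [My nt ->]]].
rewrite -map_take seq_mul_localization // (nth_map 0) // mulrA -tofracM.
move=> [z [s [Nz ns e]]].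
have hN := submodule_seq_mul (take i f) hM; have [_ _ NZ] := hN.
exists (h s * y), (s * t); split; last 1 first.
- by rewrite rmorphM !tofracM -mulf_div divff ?mul1r ?tofrac_neq0.
- apply: reg => //; first by apply: MZ => //; exists s.
  suff -> : f`_i * (h s * y) = h t * z by apply: NZ => //; exists t.
  apply/eqP; rewrite -tofrac_eq !tofracM; move/eqP: e.
  by rewrite tofracM eqr_div ?tofrac_neq0 // => /eqP e;
    rewrite mulrCA mulrC e mulrC.
- exact: mM.
Qed.

End Localization.

(** * Rational cones and support forms *)

Lemma common_denominator k (b : 'I_k -> rat) : (forall i, 0 <= b i) ->
  exists (m : nat) (c : 'I_k -> nat),
    (0 < m)%N /\ forall i, b i * m%:R = (c i)%:R.
Proof.
move=> b0; pose m := (\prod_i `|denq (b i)|)%N.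
exists m, (fun i => `|numq (b i)| * \prod_(j | j != i) `|denq (b j)|)%N.
split; first by rewrite prodn_gt0 // => i; rewrite absz_gt0 denq_neq0.
move=> i; rewrite /m (bigD1 i) //= !natrM mulrA; congr (_ * _).
rewrite !natr_absz !ger0_norm ?numq_ge0 ?denq_ge0 // -{1}(divq_num_den (b i)).
by rewrite divfK // intr_eq0 denq_neq0.
Qed.

(* Caratheodory's reduction to linearly independent vectors, whose coefficients
   are then rational. *)
Lemma rational_cone (F : realFieldType) r k (x : 'I_k -> 'rV[int]_r)
    (a : 'I_k -> F) (v : 'rV[int]_r) :
  (forall i, 0 <= a i) ->
  map_mx intr v = \sum_i a i *: map_mx intr (x i) ->
  exists (m : nat) (c : 'I_k -> nat),
    (0 < m)%N /\ v *+ m = \sum_i x i *+ c i.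
Proof.
elim: k x a => [|k IH] x a a0 vE.
  exists 1%N, (fun=> 0%N); split=> //; move: vE;
    rewrite !big_ord0 => /matrixP vE.
  by apply/matrixP => i j; have := vE i j; rewrite !mxE => /eqP;
    rewrite intr_eq0 => /eqP.
pose XZ : 'M[int]_(k.+1, r) := \matrix_i x i.
pose XF : 'M[F]_(k.+1, r) := map_mx intr XZ.
have rowXF i : row i XF = map_mx intr (x i) by rewrite -map_row rowK.
have vX : map_mx intr v = (\row_i a i) *m XF.
  by rewrite mulmx_sum_row vE; apply: eq_bigr => i _; rewrite mxE rowXF.
have [free|nfree] := boolP (row_free XF).
  pose XQ : 'M[rat]_(k.+1, r) := map_mx intr XZ.
  have ratrZ p q (M : 'M[int]_(p, q)) :
      map_mx intr M = map_mx ratr (map_mx intr M : 'M[rat]_(p, q))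
      :> 'M[F]_(p, q).
    by apply/matrixP => i j; rewrite !mxE ratr_int.
  (* Membership in a row space with rational entries descends from [F] to the rationals, and
     independence of the rows identifies the rational coefficients with the [a i]. *)
  have : (map_mx intr v <= XQ)%MS.
    by rewrite -(map_submx (@ratr F)) -!ratrZ vX submxMl.
  case/submxP => b bE.
  have aE : \row_i a i = map_mx ratr b.
    by apply: (row_free_inj free); rewrite -vX ratrZ bE map_mxM -ratrZ.
  have b0 i : 0 <= b 0 i.
    by have := a0 i; move/rowP: aE => /(_ i); rewrite !mxE => ->; rewrite ler0q.
  have [m [c [m0 hc]]] := common_denominator b0.
  exists m, c; split=> //; apply/rowP => j.
  have /rowP/(_ j) := bE; rewrite !mxE => vj.
  apply: (@intr_inj rat); rewrite mulmxnE summxE rmorphMn /= vj rmorph_sum /=.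
  rewrite -mulr_natr mulr_suml; apply: eq_bigr => i _.
  by rewrite mulmxnE rmorphMn /= !mxE mulrAC hc mulr_natl.
have [c [cX [i0 ci0]]] :
    exists c : 'rV[F]_k.+1, c *m XF = 0 /\ exists i, 0 < c 0 i.
  have := nfree; rewrite -kermx_eq0 => /rowV0Pn[c /sub_kermxP cX].
  case/rV0Pn => i; rewrite neq_lt => /orP[ci|ci]; last first.
    by exists c; split=> //; exists i.
  by exists (- c); rewrite mulNmx cX oppr0; split=> //; exists i;
    rewrite mxE oppr_gt0.
(* With the ratio least among the positive [c 0 i], subtracting that multiple of the relation [c]
   kills one coefficient and leaves the others nonnegative. *)
case: (@arg_minP _ F _ i0 (fun i => 0 < c 0 i) (fun i => a i / c 0 i) ci0) =>
  i ci imin.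
pose a' j := a j - a i / c 0 i * c 0 j.
have a'0 j : 0 <= a' j.
  rewrite subr_ge0; have [cj|cj] := ltP 0 (c 0 j).
    by rewrite -ler_pdivlMr // imin.
  apply: le_trans (a0 j); rewrite mulr_ge0_le0 // divr_ge0 // ltW //.
have vE' : map_mx intr v = \sum_j a' j *: map_mx intr (x j).
  rewrite vE; apply/eqP; rewrite -subr_eq0 -sumrB.
  have -> : \sum_j (a j *: map_mx intr (x j) - a' j *: map_mx intr (x j))
      = (a i / c 0 i) *: (c *m XF).
    rewrite mulmx_sum_row scaler_sumr; apply: eq_bigr => j _.
    by rewrite -scalerBl /a' subKr scalerA rowXF.
  by rewrite cX scaler0.
have a'i : a' i = 0 by rewrite /a' divfK ?subrr // gt_eqF.
move: vE'; rewrite (bigD1_ord i) //= a'i scale0r add0r => vE'.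
have [m [d [m0 hd]]] := IH (fun j => x (lift i j)) _ (fun j => a'0 (lift i j))
  vE'.
exists m, (fun j => if unlift i j is Some j' then d j' else 0%N); split=> //.
rewrite (bigD1_ord i) //= unlift_none mulr0n add0r hd.
by apply: eq_bigr => j _; rewrite liftK.
Qed.

(** * Support forms as integer-valued functions on gp(S) *)

Section SupportFormValues.
Variables (F : realType) (n r s : nat) (S : posAffineSemigroup n).
Variables (phi : 'rV[int]_n -> 'rV[int]_r) (sigma : 'M[int]_(r, s)).
Hypotheses (hnormal : normal_semigroup S) (hphi : gp_identification S phi).
Hypothesis hsigma : support_forms F S phi sigma.
Implicit Types x y : 'rV[int]_n.

Definition form_value x (i : 'I_s) : int := (phi x *m sigma) 0 i.

Lemma mem_gp x : x \in S -> gp S x.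
Proof. by move=> Sx; exists x, 0; rewrite subr0 (pas_addr_closed S).1. Qed.

Lemma gpB x y : gp S x -> gp S y -> gp S (x - y).
Proof.
have SD := (pas_addr_closed S).2.
move=> [x1 [x2 [? ? ->]]] [y1 [y2 [? ? ->]]]; exists (x1 + y2), (x2 + y1).
by split; [exact: SD|exact: SD|rewrite opprB addrACA -opprD].
Qed.

Lemma gp0 : gp S 0. Proof. exact/mem_gp/(pas_addr_closed S).1. Qed.

Lemma phi0 : phi 0 = 0.
Proof.
by apply: (addrI (phi 0)); rewrite -hphi.1 ?addr0 //; exact: gp0.
Qed.

Lemma phi_inj x y : gp S x -> gp S y -> phi x = phi y -> x = y.
Proof.
move=> gx gy e; have [z [_ uz]] := hphi.2 (phi x).
by rewrite -(uz x) // -(uz y).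
Qed.

Lemma form_value0 i : form_value 0 i = 0.
Proof. by rewrite /form_value phi0 mul0mx mxE. Qed.

Lemma form_valueD x y i : gp S x -> gp S y ->
  form_value (x + y) i = form_value x i + form_value y i.
Proof. by move=> gx gy; rewrite /form_value hphi.1 // mulmxDl mxE. Qed.

Lemma form_valueB x y i : gp S x -> gp S y ->
  form_value (x - y) i = form_value x i - form_value y i.
Proof.
move=> gx gy; apply/eqP; rewrite eq_sym subr_eq -form_valueD ?subrK //.
exact: gpB.
Qed.

Lemma mem_sumS (J : Type) (l : seq J) (P : pred J) (x : J -> 'rV[int]_n) :
  (forall j, P j -> x j \in S) -> \sum_(j <- l | P j) x j \in S.
Proof.
move=> Sx; have [S0 SD] := pas_addr_closed S.
by elim/big_ind: _ => // *; apply: SD.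
Qed.

Lemma form_value_sum (J : Type) (l : seq J) (P : pred J)
    (x : J -> 'rV[int]_n) i :
  (forall j, P j -> x j \in S) ->
  form_value (\sum_(j <- l | P j) x j) i =
    \sum_(j <- l | P j) form_value (x j) i.
Proof.
move=> Sx; elim: l => [|j l IH]; first by rewrite !big_nil form_value0.
rewrite !big_cons; case: ifP => // Pj.
by rewrite form_valueD ?IH //; apply: mem_gp; [exact: Sx|exact: mem_sumS].
Qed.

Lemma phiMn x m : gp S x -> gp S (x *+ m) /\ phi (x *+ m) = phi x *+ m.
Proof.
move=> gx; elim: m => [|m [gm IH]]; first by rewrite !mulr0n phi0; split=> //;
  exact: gp0.
rewrite !mulrSr hphi.1 // IH; split=> //.
by rewrite -[x in _ + x]opprK -[- x]sub0r; do 2!apply: gpB => //; exact: gp0.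
Qed.

Lemma mem_mulrn x m : x \in S -> x *+ m \in S.
Proof.
move=> Sx; have [S0 SD] := pas_addr_closed S.
by elim: m => [|m IH]; rewrite ?mulr0n // mulrS; apply: SD.
Qed.

Lemma form_valueMn x m i :
  x \in S -> form_value (x *+ m) i = form_value x i *+ m.
Proof.
by move=> /mem_gp/(phiMn m)[_ e];
  rewrite /form_value e -scaler_nat -scalemxAl mxE mulr_natl.
Qed.

Lemma form_at_int i (v : 'rV[int]_r) :
  form_at sigma i (map_mx intr v : 'rV[F]_r) = ((v *m sigma) 0 i)%:~R.
Proof. by rewrite /form_at -map_mxM mxE. Qed.

Lemma form_at_linear i c (u v : 'rV[F]_r) :
  form_at sigma i (u + c *: v) = form_at sigma i u + c * form_at sigma i v.
Proof. by rewrite /form_at mulmxDl -scalemxAl !mxE. Qed.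

Lemma form_value_ge0 x i : x \in S -> 0 <= form_value x i.
Proof.
move=> Sx; have [_ /(_ (map_mx intr (phi x)))[+ _] _] := hsigma.
have cx : real_cone S phi (map_mx intr (phi x) : 'rV[F]_r).
  by exists 1%N, (fun=> x), (fun=> 1); split; rewrite ?big_ord1 ?scale1r.
by move=> /(_ cx i); rewrite form_at_int ler0z.
Qed.

(** Such a point lies in the real cone; by [rational_cone] a positive multiple of it is a sum of
    elements of S, and normality removes the multiple. *)
Lemma form_value_ge0_mem x :
  gp S x -> (forall i, 0 <= form_value x i) -> x \in S.
Proof.
move=> gx hx; have [_ /(_ (map_mx intr (phi x)))[_ +] _] := hsigma.
case=> [i|k [y [a [Sy a0 xE]]]]; first by rewrite form_at_int ler0z; apply: hx.
have [m [c [m0 hc]]] := rational_cone a0 xE.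
apply: (hnormal gx m0); have [gm phim] := phiMn m gx.
pose z := \sum_i y i *+ c i.
have Sz : z \in S by apply: mem_sumS => i _; apply: mem_mulrn.
suff -> : x *+ m = z by [].
apply: phi_inj => //; first exact: mem_gp.
rewrite phim hc /z; elim: (index_enum _) => [|i l IH].
  by rewrite !big_nil phi0.
have gy : gp S (y i) by apply: mem_gp.
rewrite !big_cons hphi.1 ?IH ?(phiMn _ gy).2 //;
  first by case: (phiMn (c i) gy).
by apply: mem_gp; apply: mem_sumS => j _; apply: mem_mulrn.
Qed.

Lemma form_value_eq0 x : x \in S -> (forall i, form_value x i = 0) -> x = 0.
Proof.
move=> Sx x0; apply: (pas_positive Sx); rewrite -[- x]sub0r.
apply: form_value_ge0_mem => [|i]; first by apply: gpB (mem_gp Sx); exact: gp0.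
by rewrite form_valueB ?form_value0 ?x0 //; [exact: gp0|exact: mem_gp].
Qed.

(** A form vanishing on S would vanish on gp(S), hence on the unit vectors of Z^r, and the gcd of
    its coefficients would be 0 instead of 1. Summing, over all forms, elements where each is
    positive gives [p]. *)
Lemma interior_element : exists2 p, p \in S & forall i, 0 < form_value p i.
Proof.
have pos i : exists2 x, x \in S & 0 < form_value x i.
  apply: contrapT => nex; have [+ _ _] := hsigma; move=> /(_ i).
  have S0 x : x \in S -> form_value x i = 0.
    move=> Sx; apply/eqP; have := form_value_ge0 i Sx.
    by rewrite le0r => /orP[//|?]; case: nex; exists x.
  rewrite big1 // => j _; have [z [[gz phiz] _]] := hphi.2 (delta_mx 0 j).
  have [y [w [Sy Sw zE]]] := gz.
  have : form_value z i = 0.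
    by rewrite zE form_valueB ?S0 ?subr0 //; apply: mem_gp.
  by rewrite /form_value phiz -rowE mxE => ->.
have [p hp] := choice (fun i => let: ex_intro2 x Sx x0 := pos i in
  ex_intro (fun x => x \in S /\ 0 < form_value x i) x (conj Sx x0)).
exists (\sum_i p i); first by apply: mem_sumS => i _; case: (hp i).
move=> i; rewrite form_value_sum; last by move=> j _; case: (hp j).
rewrite (bigD1 i) //= ltr_pwDl //; first by case: (hp i).
by apply: sumr_ge0 => j _; apply: form_value_ge0; case: (hp j).
Qed.

(** Irredundancy supplies a point [v] violating only the inequality of index [t]. Moving from [v] in
    the direction of an interior element, one reaches the hyperplane of that form at a point [q]
    where all other forms are positive. *)
Lemma facet_element t : exists x,
  [/\ x \in S, form_value x t = 0 & forall i, i != t -> 0 < form_value x i].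
Proof.
have [_ hcone /(_ t) irr] := hsigma; have [p Sp p0] := interior_element.
have [v [ncv vge0]] : exists v : 'rV[F]_r, ~ real_cone S phi v /\
    forall j, j != t -> 0 <= form_at sigma j v.
  apply: contrapT => /forallNP nex; apply: irr => v; split.
    by move=> /hcone + j _; apply.
  by move=> vge0; apply: contrapT => ncv; apply: (nex v).
have vt : form_at sigma t v < 0.
  rewrite ltNge; apply/negP => vt; apply: ncv; apply/hcone => i.
  by have [->|] := eqVneq i t; last exact: vge0.
pose pF : 'rV[F]_r := map_mx intr (phi p).
have pFE i : form_at sigma i pF = (form_value p i)%:~R by exact: form_at_int.
have pF0 i : 0 < form_at sigma i pF by rewrite pFE ltr0z.
pose c := - form_at sigma t v / form_at sigma t pF.
have c0 : 0 < c by rewrite divr_gt0 // oppr_gt0.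
pose q := v + c *: pF.
have qt : form_at sigma t q = 0.
  by rewrite form_at_linear /c divfK ?gt_eqF // subrr.
have qpos i : i != t -> 0 < form_at sigma i q.
  by move=> it; rewrite form_at_linear ltr_wpDl ?vge0 // mulr_gt0.
have [k [x [a [Sx a0 qE]]]] : real_cone S phi q.
  apply/hcone => i; have [->|it] := eqVneq i t; first by rewrite qt.
  exact/ltW/qpos.
have qsum i : form_at sigma i q = \sum_j a j * (form_value (x j) i)%:~R.
  rewrite qE /form_at mulmx_suml summxE; apply: eq_bigr => j _.
  by rewrite -scalemxAl mxE; congr (_ * _); apply: form_at_int.
have term0 i j : 0 <= a j * (form_value (x j) i)%:~R.
  by rewrite mulr_ge0 // ler0z form_value_ge0.
(* The form of index [t] is a sum of nonnegative terms vanishing at [q], so it vanishes on every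
   generator that really occurs; their unweighted sum replaces the real point [q] by an element of
   S. *)
exists (\sum_(j | a j != 0) x j); split; first exact: mem_sumS.
  rewrite form_value_sum // big1 // => j aj.
  have : \sum_j a j * (form_value (x j) t)%:~R = 0 by rewrite -qsum.
  move/eqP; rewrite psumr_eq0 // => /allP/(_ j (mem_index_enum _)) /=.
  by rewrite mulf_eq0 (negbTE aj) intr_eq0 => /eqP.
move=> i it; rewrite form_value_sum // lt0r sumr_ge0 ?andbT; last first.
  by move=> j _; apply: form_value_ge0.
apply/negP; rewrite psumr_eq0 => [/allP all0|j _]; last exact: form_value_ge0.
have := qpos i it; rewrite qsum big1 ?ltxx // => j _.
have := all0 j (mem_index_enum _); have [->|aj] := eqVneq (a j) 0.
  by rewrite mul0r.
by move=> /eqP ->; rewrite mulr0.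
Qed.

End SupportFormValues.

(** * The standard embedding *)

Section Embedding.
Variables (F : realType) (K : fieldType) (n r s : nat).
Variable S : posAffineSemigroup n.
Variables (phi : 'rV[int]_n -> 'rV[int]_r) (sigma : 'M[int]_(r, s)).
Hypotheses (hnormal : normal_semigroup S) (hphi : gp_identification S phi).
Hypothesis hsigma : support_forms F S phi sigma.

Local Notation R := (sg_alg K S).
Local Notation P := (mpoly s K).
Local Notation exponent := (std_exponent phi sigma).
Local Notation form := (form_value phi sigma).
Local Notation m := (irrelevant_ideal K S).
Local Notation mono x := (mkmalgU x (1 : K) : R).
Local Notation coef1 := (@monalg.mcoeff (sg_elt S) K (sg_one S)).

Lemma sval_mem (x : sg_elt S) : sval x \in S.
Proof. exact: (svalP x). Qed.

Lemma std_exponentE (x : sg_elt S) i : (exponent x i)%:Z = form (sval x) i.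
Proof.
by rewrite mnmE gez0_abs //; exact: (form_value_ge0 hsigma i (sval_mem x)).
Qed.

Lemma std_exponentM (x y : sg_elt S) :
  exponent (sg_mul x y) = (exponent x + exponent y)%MM.
Proof.
apply/mnmP => i; rewrite mnmDE; apply/eqP;
  rewrite -eqz_nat PoszD !std_exponentE.
by rewrite (form_valueD _ hphi) //; apply: mem_gp; exact: sval_mem.
Qed.

Lemma std_exponent1 : exponent (sg_one S) = 0%MM.
Proof.
apply/mnmP => i; rewrite mnm0E; apply/eqP; rewrite -eqz_nat std_exponentE.
by rewrite (form_value0 _ hphi).
Qed.

Lemma std_exponent_eq0 (x : sg_elt S) : exponent x = 0%MM -> x = sg_one S.
Proof.
move=> x0; apply: val_inj; apply: (form_value_eq0 hnormal hphi hsigma).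
  exact: sval_mem.
by move=> i; rewrite -std_exponentE x0 mnm0E.
Qed.

(** The difference has nonnegative support forms, so it lies in S: divisibility in P between
    monomials of R descends to R. *)
Lemma std_exponent_le (x y : sg_elt S) :
  (exponent x <= exponent y)%MM -> exists z, y = sg_mul x z.
Proof.
move=> /mnm_lepP le; have [Sx Sy] := (sval_mem x, sval_mem y).
have Syx : sval y - sval x \in S.
  apply: (form_value_ge0_mem hnormal hphi hsigma).
    by apply: gpB; apply: mem_gp.
  move=> i; rewrite (form_valueB _ hphi) ?subr_ge0 -?std_exponentE ?lez_nat //;
    exact: mem_gp.
by exists (exist (fun z => z \in S) _ Syx); apply: val_inj;
  rewrite /= addrC subrK.
Qed.

Lemma exponent_mmorphism :
  monalg.mmorphism (fun x : sg_elt S => mpolyX K (exponent x)).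
Proof.
split=> [x y|]; first by rewrite -mpolyXD -std_exponentM.
by rewrite std_exponent1 mpolyX0.
Qed.

Definition exponent_mmorph : MMorphism.type (sg_elt S) P :=
  HB.pack (fun x : sg_elt S => mpolyX K (exponent x))
    (monalg.isMultiplicative.Build _ _ _ exponent_mmorphism).

Lemma std_embedding_rmorphism : exists f : {rmorphism R -> P},
  f = std_embedding K S phi sigma :> (R -> P).
Proof. by exists (monalg.mmap (@mpolyC s K) exponent_mmorph). Qed.

Variable embedding : {rmorphism R -> P}.
Hypothesis embeddingE : embedding = std_embedding K S phi sigma :> (R -> P).

Lemma embedding_mono x : embedding (mono x) = 'X_[exponent x].
Proof. by rewrite embeddingE /std_embedding mmapU /= mpolyC1 mul1r. Qed.

Lemma msupp_embedding a e : e \in msupp (embedding a) ->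
  exists2 x, monalg.mcoeff x a != 0 & e = exponent x.
Proof.
rewrite embeddingE /std_embedding /monalg.mmap => /msupp_sum_le /flattenP[_
  /mapP[x _ ->]].
rewrite mul_mpolyC; have [->|ax] := eqVneq (monalg.mcoeff x a) 0.
  by rewrite scale0r msupp0.
by rewrite msuppMCX // inE => /eqP ->; exists x.
Qed.

Lemma embedding_coef0 a : (embedding a)@_0 = coef1 a.
Proof.
rewrite [in RHS](monalgE a) embeddingE /std_embedding /monalg.mmap !raddf_sum
  /=; apply: eq_bigr => x _.
rewrite mul_mpolyC mcoeffZ mcoeffX monalg.mcoeffU mulr_natr;
  congr (_ *+ nat_of_bool _).
have [->|nx] := eqVneq x (sg_one S); first by rewrite std_exponent1 !eqxx.
by apply/eqP => /std_exponent_eq0/eqP; rewrite (negbTE nx).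
Qed.

(** * The irrelevant ideal as the kernel of the augmentation *)

Lemma monoM x y c : mkmalgU x c * mono y = mkmalgU (sg_mul x y) c :> R.
Proof. by apply: etrans (malgM_def _ _) _; rewrite fgmulUU mulr1. Qed.

Lemma coef1_mono x : coef1 (mono x) = (x == sg_one S)%:R.
Proof. by rewrite monalg.mcoeffU. Qed.

Lemma coef1M a b : coef1 (a * b) = coef1 a * coef1 b.
Proof. exact: (rmorphM (monalg.mcoeff (monalg.one : sg_elt S))). Qed.

Lemma coef1_1 : coef1 (1 : R) = 1.
Proof. exact: (rmorph1 (monalg.mcoeff (monalg.one : sg_elt S))). Qed.

Lemma irrelevant_coef1 a : m a -> coef1 a = 0.
Proof.
move=> [k [u [b [hb ->]]]]; rewrite raddf_sum big1 // => i _.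
rewrite [LHS]coef1M; have [[x ->] nu] := hb i; rewrite coef1_mono.
have [x1|] := eqVneq; last by rewrite mulr0.
by case: nu; exists 1; rewrite mulr1 x1.
Qed.

Lemma mono_neq1_irrelevant x : x != sg_one S ->
  monomial (mono x) /\ ~ exists b, mono x * b = 1.
Proof.
move=> x1; split; first by exists x.
move=> [b xb].
have : coef1 (mono x) * coef1 b = 1.
  exact: etrans (esym (coef1M _ _)) (etrans (congr1 _ xb) coef1_1).
by rewrite coef1_mono (negbTE x1) mul0r => /esym/eqP; rewrite oner_eq0.
Qed.

Lemma semigroup_generators : exists l : seq (sg_elt S),
  (forall g, g \in l -> g != sg_one S) /\
  forall x, x != sg_one S -> exists g y, g \in l /\ x = sg_mul g y.
Proof.
have [k [e he]] := pas_fg S.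
have Se i : e i \in S.
  apply/he; exists (fun j => (j == i)%N : nat);
    rewrite (bigD1 i) //= eqxx mulr1n.
  by rewrite big1 ?addr0 // => j /negbTE ->; rewrite mulr0n.
pose E i : sg_elt S := exist (fun z => z \in S) (e i) (Se i).
exists [seq E i | i <- enum 'I_k & e i != 0]; split.
  move=> g /mapP[i]; rewrite mem_filter => /andP[ei _] ->.
  by apply: contraNneq ei => /(congr1 val) /= ->.
move=> x x1; have [a xE] := (he (sval x)).1 (svalP x).
have [i /andP[ei ai]] : exists i, (e i != 0) && (a i != 0%N).
  apply/existsP; apply: contraNT x1; rewrite negb_exists => /forallP a0.
  apply/eqP/val_inj; rewrite /= xE big1 // => i _.
  by have := a0 i; rewrite negb_and !negbK => /orP[/eqP ->|/eqP ->];
    rewrite ?mul0rn ?mulr0n.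
pose a' j := if j == i then (a i).-1 else a j.
have Sy : \sum_j e j *+ a' j \in S by apply/he; exists a'.
exists (E i), (exist (fun z => z \in S) _ Sy); split.
  by apply: map_f; rewrite mem_filter ei mem_enum.
apply: val_inj; rewrite /= xE (bigD1 i) //= [in RHS](bigD1 i) //= addrA.
rewrite /a' eqxx -mulrS prednK ?lt0n //; congr (_ + _).
by apply: eq_bigr => j /negbTE ->.
Qed.

Lemma irrelevant_generators : exists G : seq R,
  (forall g, g \in G -> m g) /\
  forall a, coef1 a = 0 -> seq_mul (fun=> True) G a.
Proof.
have [l [l1 hl]] := semigroup_generators.
exists [seq mono g | g <- l]; split.
  move=> y /mapP[g gl ->]; exists 1%N, (fun=> 1), (fun=> mono g).
  by split=> [_|]; [exact: mono_neq1_irrelevant (l1 _ gl)|rewrite big_ord1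
    mul1r].
move=> a a1.
have hG : submodule (fun=> True) (seq_mul (fun=> True) [seq mono g | g <- l]).
  exact: submodule_seq_mul.
rewrite (monalgE a); apply: (submodule_sum _ hG) => x.
have [_ _ GZ] := hG; have [x1|x1] := eqVneq x (sg_one S).
  by rewrite x1 a1 monalgU0; case: hG.
have [g [y [gl xE]]] := hl x x1.
have -> : mkmalgU x (monalg.mcoeff x a) =
    mkmalgU y (monalg.mcoeff x a) * mono g :> R.
  by rewrite monoM xE sg_mulC.
by apply: GZ => //; apply: mem_seq_mul; apply: map_f.
Qed.

Lemma irrelevantE a : m a <-> coef1 a = 0.
Proof.
split=> [|a1]; first exact: irrelevant_coef1.
pose l := in_tuple (finmap.enum_fset (monalg.msupp a)).
exists (size (finmap.enum_fset (monalg.msupp a))),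
  (fun i => mkmalgU (sg_one S) (monalg.mcoeff (tnth l i) a)),
  (fun i => mono (tnth l i)); split.
  move=> i; apply: mono_neq1_irrelevant; have := mem_tnth i l.
  by rewrite -mcoeff_neq0; apply: contraNneq => ->; rewrite a1.
rewrite {1}(monalgE a) big_tnth; apply: eq_bigr => i _.
by rewrite monoM sg_mul1.
Qed.

Lemma not_irrelevantE t : ~ m t <-> coef1 t != 0.
Proof. by split=> [nt|/eqP nt /irrelevantE //]; apply/eqP => /irrelevantE. Qed.

Lemma not_irrelevant1 : ~ m 1.
Proof. by apply/not_irrelevantE; rewrite coef1_1 oner_eq0. Qed.

Lemma not_irrelevantM a b : ~ m a -> ~ m b -> ~ m (a * b).
Proof.
by move=> /not_irrelevantE na /not_irrelevantE nb; apply/not_irrelevantE;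
  rewrite coef1M mulf_neq0.
Qed.

Lemma embedding_neq0 t : ~ m t -> embedding t != 0.
Proof.
move=> /not_irrelevantE nt; apply: contraNneq nt => t0.
by rewrite -embedding_coef0 t0 mcoeff0.
Qed.

(** * The modules M_c *)

Definition exponent_class (e : 'X_{1..s}) : class_group sigma :=
  residue_class sigma (\row_i (e i)%:Z).

Lemma residue_classD (a b : 'rV[int]_s) :
  residue_class sigma (a + b) = residue_class sigma a + residue_class sigma b.
Proof. exact: Quotient.pi_add. Qed.

Lemma residue_class_form (z : 'rV[int]_r) :
  residue_class sigma (z *m sigma) = 0.
Proof.
have -> : 0 = residue_class sigma 0.
  by apply: (addIr (residue_class sigma 0)); rewrite -residue_classD !add0r.
apply/eqP; rewrite /residue_class -Quotient.idealrBE subr0.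
by apply/asboolP; exists z.
Qed.

Lemma exponent_classD e e' :
  exponent_class (e + e')%MM = exponent_class e + exponent_class e'.
Proof.
rewrite -residue_classD; congr residue_class.
by apply/rowP => i; rewrite !mxE mnmDE PoszD.
Qed.

Lemma exponent_class_embedding a e :
  e \in mpoly.msupp (embedding a) -> exponent_class e = 0.
Proof.
case/msupp_embedding => x _ ->; rewrite -(residue_class_form (phi (sval x))).
by congr residue_class; apply/rowP => i; rewrite mxE std_exponentE.
Qed.

Definition restrict (Q : pred 'X_{1..s}) (p : P) : P :=
  \sum_(e <- mpoly.msupp p | Q e) p@_e *: 'X_[e].

Lemma restrict_coef Q p e : (restrict Q p)@_e = if Q e then p@_e else 0.
Proof.
rewrite /restrict raddf_sum /= big_mkcond /=.
have [ep|ep] := boolP (e \in mpoly.msupp p); last first.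
  rewrite (memN_msupp_eq0 ep) if_same big_seq big1 // => e' e'p.
  case: ifP => // _; rewrite mcoeffZ mcoeffX; have [ee|_] := eqVneq e' e.
    by rewrite -ee e'p in ep.
  by rewrite mulr0.
rewrite (bigD1_seq e) ?msupp_uniq //= big1 ?addr0 => [|e' ne].
  by rewrite mcoeffZ mcoeffX eqxx mulr1.
by case: ifP => // _; rewrite mcoeffZ mcoeffX (negbTE ne) mulr0.
Qed.

Lemma restrictB Q p q : restrict Q (p - q) = restrict Q p - restrict Q q.
Proof.
apply/mpolyP => e; rewrite mcoeffB !restrict_coef mcoeffB.
by case: ifP; rewrite ?subr0.
Qed.

Lemma restrictD Q p q : restrict Q (p + q) = restrict Q p + restrict Q q.
Proof.
apply/mpolyP => e; rewrite mcoeffD !restrict_coef mcoeffD.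
by case: ifP; rewrite ?addr0.
Qed.

Lemma restrict_mul (Q : pred 'X_{1..s}) p q :
  (forall e, e \in mpoly.msupp q -> forall e', Q (e + e')%MM = Q e') ->
  restrict Q (q * p) = q * restrict Q p.
Proof.
move=> hq; apply/mpolyP => e; rewrite restrict_coef !mcoeffM.
have [Qe|nQe] := boolP (Q e); last apply/esym.
  apply: eq_bigr => k /eqP ek; rewrite restrict_coef.
  have [kq|/memN_msupp_eq0 ->] := boolP (val k.1 \in mpoly.msupp q).
    by rewrite -(hq _ kq) -ek Qe.
  by rewrite !mul0r.
apply: big1 => k /eqP ek; rewrite restrict_coef.
have [kq|/memN_msupp_eq0 ->] := boolP (val k.1 \in mpoly.msupp q).
  by rewrite -(hq _ kq) -ek (negbTE nQe) mulr0.
by rewrite mul0r.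
Qed.

Implicit Types (c : class_group sigma) (p q : P).

Definition class_proj (c : class_group sigma) : P -> P :=
  restrict (fun e => exponent_class e == - c).

(** Elements of R have all their exponents in class zero, so multiplying by them respects the
    grading of P by Cl(R). *)
Lemma class_projM c a p :
  class_proj c (embedding a * p) = embedding a * class_proj c p.
Proof.
apply: restrict_mul => e /exponent_class_embedding e0 e'.
by rewrite exponent_classD e0 add0r.
Qed.

Lemma class_moduleE c p : class_module K c p <-> class_proj c p = p.
Proof.
split=> [hp|<- e].
  apply/mpolyP => e; rewrite restrict_coef; case: ifP => // /negP ne.
  by apply/esym/memN_msupp_eq0/negP => /hp /eqP.
rewrite mcoeff_msupp restrict_coef; case: ifP => [/eqP //|_].
by rewrite eqxx.
Qed.

Lemma class_proj_in c p : class_module K c (class_proj c p).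
Proof.
apply/class_moduleE/mpolyP => e; rewrite !restrict_coef.
by case: (_ == _).
Qed.

Lemma submodule_class_module c : submodule (image embedding) (class_module K c).
Proof.
split.
- by apply/class_moduleE/mpolyP => e; rewrite restrict_coef mcoeff0 if_same.
- move=> p q /class_moduleE hp /class_moduleE hq; apply/class_moduleE.
  by rewrite -[RHS](congr2 (fun x y => x - y) hp hq) -restrictB.
- move=> _ p [a ->] /class_moduleE hp; apply/class_moduleE.
  by rewrite class_projM hp.
Qed.

Lemma class_proj0 c : class_proj c 0 = 0.
Proof. by apply/mpolyP => e; rewrite restrict_coef mcoeff0 if_same. Qed.

Lemma class_proj_seq_mul c f y : (forall x, x \in f -> image embedding x) ->
  seq_mul (fun=> True) f y -> seq_mul (class_module K c) f (class_proj c y).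
Proof.
move=> hf [u [_ ->]]; exists (fun i => class_proj c (u i)).
split=> [i|]; first exact: class_proj_in.
have -> : class_proj c (\sum_(i < size f) f`_i * u i)
    = \sum_(i < size f) class_proj c (f`_i * u i).
  elim: (index_enum _) => [|i l IH]; first by rewrite !big_nil class_proj0.
  by rewrite !big_cons -IH -restrictD.
apply: eq_bigr => i _; have [|a ->] := hf f`_i; first exact: mem_nth.
exact: class_projM.
Qed.

(** Projecting the coefficients to class [c] turns a relation over P into one over M_c. Through
    this, regularity on P passes to M_c. *)
Lemma class_module_seq_mul c f y : (forall x, x \in f -> image embedding x) ->
  class_module K c y -> seq_mul (fun=> True) f y ->
  seq_mul (class_module K c) f y.
Proof. by move=> hf /class_moduleE {2}<-; apply: class_proj_seq_mul. Qed.

Lemma sum_class_proj p :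
  p = \sum_(c <- undup [seq - exponent_class e | e <- mpoly.msupp p])
    class_proj c p.
Proof.
apply/mpolyP => e; rewrite raddf_sum /=.
have [ep|ep] := boolP (e \in mpoly.msupp p); last first.
  rewrite (memN_msupp_eq0 ep) big1 // => c _.
  by rewrite restrict_coef (memN_msupp_eq0 ep) if_same.
rewrite (bigD1_seq (- exponent_class e)) ?undup_uniq //=; last first.
  by rewrite mem_undup; apply: (map_f (fun e => - exponent_class e)).
rewrite restrict_coef opprK eqxx big1 ?addr0 // => c ce.
rewrite restrict_coef; case: eqP => // ec.
by rewrite ec opprK eqxx in ce.
Qed.

(** * Grades and depths *)

Variable G : seq R.
Hypotheses (Gm : forall g, g \in G -> m g).
Hypothesis hG : forall a, coef1 a = 0 -> seq_mul (fun=> True) G a.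

Local Notation ideal := (submodule (fun=> True)).
Local Notation GP := (map embedding G).

Lemma irrelevant_combination a : m a ->
  combination (image embedding) GP (embedding a).
Proof.
move=> /irrelevantE /hG /(seq_mulP _ _ I)[u [_ ->]].
exists (fun i => embedding (u i)); split=> [i|]; first by exists (u i).
rewrite size_map rmorph_sum /=; apply: eq_big_nat => i /andP[_ lti].
by rewrite rmorphM mulrC (nth_map 0).
Qed.

Lemma extended_combination y :
  extended_irrelevant_ideal K S phi sigma y -> combination (fun=> True) GP y.
Proof.
move=> [k [u [b [hb ->]]]].
have cI i : combination (fun=> True) GP (b i).
  have [a [ma ->]] := hb i; rewrite -embeddingE.
  exact: combination_sub (irrelevant_combination ma).
have [v hv] := choice cI.
exists (fun j => \sum_i u i * v i j); split=> //.
rewrite (eq_bigr (fun i => \sum_(0 <= j < size GP) u i * v i j * GP`_j)).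
  by rewrite exchange_big; apply: eq_bigr => j _; rewrite mulr_suml.
move=> i _; have [_ {1}->] := hv i; rewrite mulr_sumr.
by apply: eq_bigr => j _; rewrite mulrA.
Qed.

Lemma embedding_extended a : m a ->
  extended_irrelevant_ideal K S phi sigma (embedding a).
Proof.
move=> ma; exists 1%N, (fun=> 1), (fun=> embedding a).
by split=> [_|]; [exists a; rewrite -embeddingE|rewrite big_ord1 mul1r].
Qed.

Lemma seq_mul_coef0 (p : P) l : (forall g, g \in l -> (g : P)@_0 = 0) ->
  seq_mul (fun=> True) l p -> p@_0 = 0.
Proof.
move=> hl [u [_ ->]]; rewrite raddf_sum big1 // => i _ /=.
by rewrite (rmorphM (@mcoeff s K 0%MM)) /= hl ?mul0r // mem_nth.
Qed.

Lemma one_notin_seq_mul l :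
  (forall x, x \in l -> exists2 a, m a & x = embedding a) ->
  ~ seq_mul (fun=> True) l (1 : P).
Proof.
move=> hl; have l0 g : g \in l -> (g : P)@_0 = 0.
  by move=> /hl[a /irrelevantE a0 ->]; rewrite embedding_coef0.
by move=> /(seq_mul_coef0 l0)/eqP; rewrite mcoeff1 eqxx oner_eq0.
Qed.

Lemma GP_irrelevant x : x \in GP -> exists2 a, m a & x = embedding a.
Proof. by move=> /mapP[a /Gm ma ->]; exists a. Qed.

(** A longest sequence exists because lengths are bounded by the number of generators of m; the
    quotient of P stays nonzero since elements of m have constant term zero. *)
Lemma maximal_regular_sequence : exists x : seq P,
  [/\ forall z, z \in x -> exists2 a, m a & z = embedding a,
      regular_seq (fun=> True) x
    & exists y, ~ seq_mul (fun=> True) x y /\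
        forall a, m a -> seq_mul (fun=> True) x (embedding a * y)].
Proof.
pose L k := exists x : seq P, [/\ size x = k,
  forall z, z \in x -> exists2 a, m a & z = embedding a
  & regular_seq (fun=> True) x].
have [k [[x [szx xm regx]] kmax]] : exists k, is_max L k.
  apply: (@bounded_max L 0%N (size GP)).
    by exists [::]; split=> //; apply: (@regular_seq_nil _ _ 1) => //;
      exact: oner_neq0.
  move=> k [x [<- xm regx]].
  apply: (@regular_size_le_gens _ (fun=> True) (fun=> True) GP _ _ x 1) => //.
    exact/one_notin_seq_mul/GP_irrelevant.
  move=> z /xm[a ma ->].
  exact: combination_sub (irrelevant_combination ma).
exists x; split=> //.
have hx : ideal (seq_mul (fun=> True) x) by apply: submodule_seq_mul.
pose hm z := exists2 a, m a & z = embedding a.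
have [|||z [a ma ->]|y [ny hy]] := zero_divisors_socle (m := hm)
  (@mpoly_noetherian s K) hx.
- move=> _ _ [a /irrelevantE a0 ->] [b /irrelevantE b0 ->]; exists (a + b).
    by apply/irrelevantE; rewrite monalg.mcoeffD a0 b0 addr0.
  by rewrite rmorphD.
- move=> _ _ [a /irrelevantE a0 ->] [b /irrelevantE b0 ->]; exists (a * b).
    by apply/irrelevantE; rewrite coef1M a0 mul0r.
  by rewrite rmorphM.
- by exists (embedding 0), 0 => //; apply/irrelevantE; rewrite monalg.mcoeff0.
(* An element of m regular modulo [x] could be appended to [x], against maximality. *)
- apply: contrapT => nzd.
  have xam u : u \in rcons x (embedding a) -> hm u.
    by rewrite mem_rcons inE => /orP[/eqP ->|/xm //]; exists a.
  suff /kmax : L (size (rcons x (embedding a))) by rewrite size_rcons -szx ltnn.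
  exists (rcons x (embedding a)); split=> //.
  apply: (regular_seq_rcons (submodule_all (fun=> True)) regx).
    by move=> y _ hy; apply: contrapT => ny; apply: nzd; exists y.
  by exists 1; split=> //; apply: one_notin_seq_mul.
- by exists y; split=> // a ma; apply: hy; exists a.
Qed.

(** Generators of m also generate mP, so the socle class of [y] bounds the regular sequences with
    entries anywhere in mP, not only those coming from R. *)
Lemma extended_grade x y :
  (forall z, z \in x -> exists2 a, m a & z = embedding a) ->
  regular_seq (fun=> True) x -> ~ seq_mul (fun=> True) x y ->
  (forall a, m a -> seq_mul (fun=> True) x (embedding a * y)) ->
  is_grade (extended_irrelevant_ideal K S phi sigma) (size x).
Proof.
move=> xm regx ny hy; split.
  by exists x; split=> // z /xm[a ma ->]; apply: embedding_extended.
move=> k [f [<- fm regf]].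
apply: (@regular_size_le _ (fun=> True) (fun=> True) GP _ _ x f y) => //.
- by move=> z /xm[a ma ->]; apply: combination_sub (irrelevant_combination ma).
- by move=> z /GP_irrelevant[a ma ->]; apply: hy.
- by move=> z /fm; apply: extended_combination.
Qed.

(** Adding the forms of a large multiple of an interior element to a representative of [- c] makes
    all coordinates nonnegative and keeps the class; so every M_c contains a monomial. *)
Lemma exponent_class_surj c : exists e, exponent_class e = - c.
Proof.
have [p Sp p0] := interior_element hphi hsigma.
pose a : 'rV[int]_s := repr c.
have ca : residue_class sigma a = c by apply: reprK.
(* [N] dominates every coordinate of [a], and each form is at least 1 on [p]. *)
pose N := (\sum_i absz (a 0%R i))%N.
pose b i := form (p *+ N) i - a 0 i.
have b0 i : 0 <= b i.
  rewrite /b (form_valueMn _ hphi) // subr_ge0.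
  apply: (@le_trans _ _ `|a 0 i|); first exact: ler_norm.
  apply: (@le_trans _ _ (N%:Z)).
    by rewrite -abszE lez_nat /N (bigD1 i) //= leq_addr.
  rewrite -[X in X <= _](natz N) lerMn2r; apply/orP; right.
  by rewrite -gtz0_ge1.
exists [multinom absz (b i) | i < s].
rewrite /exponent_class.
have -> : \row_i ([multinom absz (b i) | i < s] i)%:Z =
    phi (p *+ N) *m sigma + (- a).
  by apply/rowP => i; rewrite !mxE mnmE gez0_abs // /b /form_value mxE.
rewrite residue_classD residue_class_form add0r -ca.
apply/eqP; rewrite -addr_eq0 -residue_classD addNr -(mul0mx _ sigma).
by rewrite residue_class_form.
Qed.

(** Take a monomial of least degree in M_c. Its coefficient in [embedding t * y] is the nonzero
    constant term of [t], while for degree reasons it has coefficient zero in every element of m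
    M_c. The factor [t] prepares for localization. *)
Lemma class_module_minimal_generator c : exists y,
  class_module K c y /\
  forall t, ~ m t -> ~ seq_mul (class_module K c) GP (embedding t * y).
Proof.
have ex : exists d, `[< exists2 e, exponent_class e = - c & mdeg e = d >].
  by have [e he] := exponent_class_surj c; exists (mdeg e); apply/asboolP;
    exists e.
have [_ /asboolP[e he <-] emin] := ex_minnP ex.
exists 'X_[e]; split.
  by move=> e'; rewrite msuppX inE => /eqP ->.
move=> t /not_irrelevantE t0 [u [hu /(congr1 (mcoeff e))]].
rewrite -{1}[e]addm0 mcoeffMX embedding_coef0 raddf_sum big1 => [/eqP|i _].
  by apply/negP.
have [|a /irrelevantE a0 ->] := @GP_irrelevant GP`_i; first exact: mem_nth.
rewrite /= mcoeffM big1 // => k /eqP ek.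
have [k2u|/memN_msupp_eq0 ->] := boolP (val k.2 \in mpoly.msupp (u i));
  last by rewrite mulr0.
have [k10|k10] := eqVneq (val k.1) 0%MM.
  by rewrite k10 embedding_coef0 a0 mul0r.
(* Minimality of [e] is incompatible with a splitting of [e] whose first part is nonzero. *)
have : (mdeg e <= mdeg (val k.2))%N.
  by apply: emin; apply/asboolP; exists (val k.2) => //; apply: (hu i).
by rewrite {1}ek mdegD -[leqRHS]add0n leq_add2r leqn0 mdeg_eq0 (negbTE k10).
Qed.

(** * Depth of M_c over R_m *)

Local Notation loc := (localization embedding m).
Local Notation GF := (map (@tofrac P) GP).

Lemma local_combination y :
  local_max_ideal embedding m y -> combination (loc (image embedding)) GF y.
Proof.
move=> [_ [t [[a [ma ->]] nt ->]]].
have [b [hb ->]] := irrelevant_combination ma.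
exists (fun i => tofrac (b i) / tofrac (embedding t)); split.
  by move=> i; exists (b i), t.
rewrite [size GF]size_map rmorph_sum mulr_suml /=.
apply: eq_big_nat => i /andP[_ lti].
by rewrite tofracM [GF`_i](nth_map 0) // mulrAC.
Qed.

Lemma GF_local g : g \in GF -> loc (image embedding) g.
Proof.
move=> /mapP[_ /GP_irrelevant[a _ ->] ->].
by apply: (localization_tofrac embedding not_irrelevant1); exists a.
Qed.

Let submodule_local c := submodule_localization not_irrelevant1
  not_irrelevantM embedding_neq0
  (submodule_class_module c).

Lemma local_depth_bound c k :
  regular_length (loc (class_module K c)) (local_max_ideal embedding m) k ->
  (k <= size GF)%N.
Proof.
move=> [f [<- fm regf]]; have [y [My ny]] := class_module_minimal_generator c.
apply: (@regular_size_le_gens _ (loc (image embedding)) (loc (class_module K c))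
  GF (submodule_local c) GF_local f (tofrac y)) => //.
- exact: (localization_tofrac embedding not_irrelevant1 My).
- rewrite seq_mul_localization //;
  [|exact: not_irrelevant1|exact: not_irrelevantM
    |exact: embedding_neq0|exact: submodule_class_module].
  have hN := submodule_seq_mul GP (submodule_class_module c).
  by case/(localization_tofracE embedding_neq0 _ hN) => t nt; apply: ny.
- by move=> z /fm; apply: local_combination.
Qed.

(** The cancellation conditions come from P by projecting to class [c]. The quotient is nonzero
    because xM_c lies in mM_c, which misses the minimal generator even after localization. *)
Lemma local_regular_sequence c x :
  (forall z, z \in x -> exists2 a, m a & z = embedding a) ->
  regular_seq (fun=> True) x ->
  regular_seq (loc (class_module K c)) (map (@tofrac P) x).
Proof.
move=> xm [reg _].
have xi z : z \in x -> image embedding z by move=> /xm[a _ ->]; exists a.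
have hM := submodule_class_module c.
have [y [My ny]] := class_module_minimal_generator c.
apply: (regular_seq_localization not_irrelevant1 not_irrelevantM
  embedding_neq0 hM).
  move=> i lti z Mz hz; apply: class_module_seq_mul => //.
    by move=> w /mem_take; apply: xi.
  by apply: reg => //; apply: seq_mul_le hz.
exists (tofrac y); split; first exact: (localization_tofrac embedding
  not_irrelevant1 My).
have hN := submodule_seq_mul x hM.
case/(localization_tofracE embedding_neq0 _ hN) => t nt hty.
apply: (ny t nt); apply: (seq_mul_combination hM _ hty) => z /xm[a ma ->].
exact: irrelevant_combination.
Qed.

Lemma local_regular_length c x :
  (forall z, z \in x -> exists2 a, m a & z = embedding a) ->
  regular_seq (fun=> True) x ->
  regular_length (loc (class_module K c)) (local_max_ideal embedding m)
    (size x).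
Proof.
move=> xm regx; exists (map (@tofrac P) x); split.
- by rewrite size_map.
- move=> _ /mapP[z /xm[a ma ->] ->].
  by apply: (localization_tofrac embedding not_irrelevant1); exists a.
- exact: local_regular_sequence.
Qed.

Lemma embedding_const (k : K) : embedding (mkmalgU (sg_one S) k) = k%:MP.
Proof.
by rewrite embeddingE /std_embedding mmapU std_exponent1 mpolyX0 mulr1.
Qed.

(** An element [t] outside m differs from a nonzero constant by an element of m, and m kills [y]
    modulo xM_c. So [t] acts on the class of [y] as an invertible scalar, and localization cannot
    kill that class. *)
Lemma local_socle c x y : class_module K c y ->
  ~ seq_mul (class_module K c) x y ->
  (forall a, m a -> seq_mul (class_module K c) x (embedding a * y)) ->
  ~ loc (seq_mul (class_module K c) x) (tofrac y).
Proof.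
move=> My ny hy; have hN := submodule_seq_mul x (submodule_class_module c).
case/(localization_tofracE embedding_neq0 _ hN) => t.
move=> /not_irrelevantE t0 hty; apply: ny.
pose k := mkmalgU (sg_one S) (coef1 t) : R.
have mt : m (t - k).
  by apply/irrelevantE; rewrite monalg.mcoeffB monalg.mcoeffUU subrr.
have [_ NB NZ] := hN.
have ht : embedding t - embedding (t - k) = (coef1 t)%:MP.
  by rewrite rmorphB opprB addrC subrK; apply: embedding_const.
have hk : embedding (mkmalgU (sg_one S) (coef1 t)^-1) = (coef1 t)^-1%:MP.
  exact: embedding_const.
have -> : y = (coef1 t)^-1%:MP * (embedding t * y - embedding (t - k) * y).
  by rewrite -mulrBl ht mulrA -mpolyCM mulVf // mpolyC1 mul1r.
by rewrite -hk; apply: NZ; [eexists|apply: NB => //; apply: hy].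
Qed.

Lemma local_depth_socle c x y :
  (forall z, z \in x -> exists2 a, m a & z = embedding a) ->
  regular_seq (fun=> True) x -> class_module K c y ->
  ~ seq_mul (class_module K c) x y ->
  (forall a, m a -> seq_mul (class_module K c) x (embedding a * y)) ->
  is_local_depth embedding m (class_module K c) (size x).
Proof.
move=> xm regx My ny hy; split; first exact: local_regular_length.
move=> k [f [<- fm regf]].
have hM := submodule_class_module c.
rewrite -(size_map (@tofrac P) x).
apply: (@regular_size_le _ (loc (image embedding)) (loc (class_module K c))
  GF (submodule_local c) GF_local _ f (tofrac y)) => //.
- move=> _ /mapP[z /xm[a ma ->] ->]; apply: local_combination.
  by apply: (localization_tofrac embedding not_irrelevant1); exists a.
- exact: local_regular_sequence.
- exact: (localization_tofrac embedding not_irrelevant1 My).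
- rewrite seq_mul_localization //; [exact: local_socle|exact: not_irrelevant1
    |exact: not_irrelevantM|exact: embedding_neq0].
- move=> _ /mapP[_ /GP_irrelevant[a ma ->] ->]; rewrite seq_mul_localization //;
    [|exact: not_irrelevant1|exact: not_irrelevantM|exact: embedding_neq0].
  by rewrite -tofracM; apply: (localization_tofrac embedding not_irrelevant1);
    apply: hy.
- by move=> z /fm; apply: local_combination.
Qed.

Lemma grade_eq_min_depth : exists (x : seq P) (d : class_group sigma -> nat),
  [/\ is_grade (extended_irrelevant_ideal K S phi sigma) (size x),
      forall c, is_local_depth embedding m (class_module K c) (d c)
    & is_min (fun k => exists c, k = d c) (size x)].
Proof.
have [x [xm regx [y [ny hy]]]] := maximal_regular_sequence.
have xi z : z \in x -> image embedding z by move=> /xm[a _ ->]; exists a.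
have depth c : exists d, is_local_depth embedding m (class_module K c) d.
  apply: bounded_max (local_regular_length c xm regx) _.
  exact: local_depth_bound.
have [d hd] := choice depth.
exists x, d; split=> //; first exact: extended_grade regx ny hy.
split; last by move=> _ [c ->]; have [_ +] := hd c; apply;
  exact: local_regular_length.
have [c nc] : exists c, ~ seq_mul (class_module K c) x (class_proj c y).
  apply: contrapT => /forallNP all; apply: ny; rewrite (sum_class_proj y).
  have hT : ideal (seq_mul (fun=> True) x) by apply: submodule_seq_mul.
  apply: (submodule_sum _ hT) => c.
  by apply: (@seq_mul_le _ (class_module K c)) => //; apply: contrapT (all c).
exists c; have [Ld dmax] := hd c.
have [Lx xmax] : is_local_depth embedding m (class_module K c) (size x).
  apply: (local_depth_socle xm regx (@class_proj_in c y) nc) => a ma.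
  by rewrite -class_projM; apply: class_proj_seq_mul => //; apply: hy.
by apply/eqP; rewrite eqn_leq dmax // xmax.
Qed.

(** * Monomial regular sequences *)

Lemma sg_mulI (x : sg_elt S) : injective (sg_mul x).
Proof. by move=> y z /(congr1 val) /addrI yz; apply: val_inj. Qed.

Lemma mono_mem (xs : seq (sg_elt S)) (w : sg_elt S) :
  seq_mul (fun=> True) [seq mono x | x <- xs] (mono w) <->
  exists x v, x \in xs /\ w = sg_mul x v.
Proof.
split=> [[u [_ wE]]|[x [v [xx ->]]]].
  apply: contrapT => nw; have : monalg.mcoeff w (mono w) != 0.
    by rewrite monalg.mcoeffUU oner_eq0.
  apply/negP/negPn/eqP; rewrite wE raddf_sum big1 // => i _.
  apply/eqP; rewrite monalg.mcoeff_eq0; apply/negP => /monalg.msuppM_le.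
  move=> [k1 [k2 [+ _ wk]]].
  have lti : (i < size xs)%N by rewrite -(size_map (fun x => mono x)).
  rewrite (nth_map (sg_one S)) // => /(finmap.fsubsetP (msuppU_le)).
  rewrite finmap.in_fset1 => /eqP k1E; apply: nw.
  by exists (nth (sg_one S) xs i), k2; rewrite mem_nth // -k1E.
rewrite sg_mulC -monoM.
have [_ _ NZ] : ideal (seq_mul (fun=> True) [seq mono x | x <- xs]).
  exact: submodule_seq_mul.
by apply: NZ => //; apply: mem_seq_mul; apply: map_f.
Qed.

(** The equality (x) : y = (x) of ideals of R, tested on monomials. *)
Definition colon_trivial (x y : sg_elt S) : Prop :=
  forall w v, sg_mul w y = sg_mul x v -> exists v', w = sg_mul x v'.

Lemma colon_trivial_sym x y : colon_trivial x y -> colon_trivial y x.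
Proof.
move=> xy w v wx; have [|v' vE] := xy v w; first by rewrite sg_mulC -wx sg_mulC.
exists v'; apply: (@sg_mulI x); rewrite sg_mulC wx vE !sg_mulA.
by rewrite (sg_mulC y).
Qed.

(** Let [w] be a large multiple of a facet element for [t]. It dominates [x] in every coordinate
    except [t], where [y] does, so [x] divides [w y]. The colon condition makes [x] divide [w],
    whose exponent at [t] is zero. *)
Lemma colon_trivial_coprime x y t : colon_trivial x y ->
  (exponent x t <= exponent y t)%N -> exponent x t = 0%N.
Proof.
move=> xy le; apply/eqP; rewrite -leqn0.
have [v [Sv vt v0]] := facet_element hphi hsigma t.
pose N := mdeg (exponent x).
pose w : sg_elt S := exist (fun z => z \in S) (v *+ N) (mem_mulrn N Sv).
have wt : exponent w t = 0%N.
  by apply/eqP; rewrite -eqz_nat std_exponentE (form_valueMn _ hphi) // vt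
    mul0rn.
have [z zE] : exists z, sg_mul w y = sg_mul x z.
  apply: std_exponent_le; apply/mnm_lepP => i; rewrite std_exponentM mnmDE.
  have [->|it] := eqVneq i t; first by rewrite wt.
  apply: (@leq_trans N); first by rewrite /N mdegE (bigD1 i) //= leq_addr.
  apply: leq_trans (leq_addr _ _); rewrite -lez_nat std_exponentE.
  rewrite (form_valueMn _ hphi) // -[X in X <= _]natz lerMn2r; apply/orP; right.
  by rewrite -gtz0_ge1; apply: v0.
have [v' /(congr1 (fun u => exponent u t))] := xy w z zE.
by rewrite wt std_exponentM mnmDE => ->; apply: leq_addr.
Qed.

Lemma regular_monomials_neq1 (xs : seq (sg_elt S)) :
  regular_seq (fun=> True) [seq mono x | x <- xs] ->
  forall x, x \in xs -> x != sg_one S.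
Proof.
move=> [_ [y [_ ny]]] x xx; apply/eqP => x1; apply: ny.
have [_ _ NZ] : ideal (seq_mul (fun=> True) [seq mono x | x <- xs]).
  exact: submodule_seq_mul.
rewrite -(mulr1 y); apply: NZ => //; apply/(mono_mem xs (sg_one S)).
by exists x, (sg_one S); split=> //; rewrite x1 sg_mul1.
Qed.

(** Regularity only places [w] in the ideal of all predecessors of [xj], say [w = x v1]. If [x] is
    not [xi], induction on [j] makes the colon of [xi] by [x] trivial, and the problem passes from
    [w] to [v1], of smaller degree. *)
Lemma regular_monomials_colon (xs : seq (sg_elt S)) :
  regular_seq (fun=> True) [seq mono x | x <- xs] ->
  forall j i, (i < j < size xs)%N ->
    colon_trivial (nth (sg_one S) xs i) (nth (sg_one S) xs j).
Proof.
move=> regxs; have x1 := regular_monomials_neq1 regxs; have [reg _] := regxs.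
elim/ltn_ind => j IHj i /andP[ltij ltj].
set xi := nth _ xs i; set xj := nth _ xs j => w.
have [N] := ubnP (mdeg (exponent w)); elim: N w => // N IHN w ltw v wv.
have ltjm : (j < size [seq mono x | x <- xs])%N by rewrite size_map.
have [|x [v1 [xtake wE]]] := (mono_mem (take j xs) w).1.
  rewrite map_take; apply: reg => //.
  rewrite (nth_map (sg_one S)) // monoM -map_take; apply/mono_mem.
  exists xi, v; split; last by rewrite sg_mulC.
  have ltit : (i < size (take j xs))%N by rewrite size_takel // ltnW.
  by rewrite /xi -(nth_take _ ltij); apply: mem_nth.
have [xx0 xx] : x != sg_one S /\ x \in xs.
  by have xx := mem_take xtake; split=> //; apply: x1.
pose k := index x xs.
have ltkj : (k < j)%N.
  have szt : size (take j xs) = j by rewrite size_takel // ltnW.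
  by rewrite /k -(cat_take_drop j xs) index_cat xtake -{2}szt index_mem.
have xk : x = nth (sg_one S) xs k by rewrite nth_index.
have [ik|nik] := eqVneq k i; first by exists v1; rewrite /xi -ik -xk.
have xix : colon_trivial xi x.
  rewrite xk; have [ltik|ltki|/eqP] := ltngtP i k;
    last by rewrite eq_sym (negbTE nik).
    by apply: IHj => //; rewrite ltik (ltn_trans ltkj).
  apply: colon_trivial_sym; apply: IHj => //.
  by rewrite ltki (ltn_trans ltij).
(* Since [xi] divides [x v1 xj], the trivial colon strips off [x] and leaves [xi] dividing
   [v1 xj]. *)
have [|v2 v2E] := xix (sg_mul v1 xj) v.
  by rewrite -wv wE sg_mulC sg_mulA.
have [|v' v1E] := IHN v1 _ v2 v2E.
  move: ltw; rewrite ltnS; apply: leq_trans.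
  rewrite wE std_exponentM mdegD -[X in (X < _)%N]add0n ltn_add2r.
  rewrite lt0n mdeg_eq0; apply: contraNneq xx0 => /std_exponent_eq0 ->.
  exact: eqxx.
by exists (sg_mul x v'); rewrite wE v1E !sg_mulA (sg_mulC x).
Qed.

Lemma monomial_ideal_mem (es : seq 'X_{1..s}) (p : P) :
  seq_mul (fun=> True) [seq 'X_[e] | e <- es] p <->
  forall e', e' \in mpoly.msupp p -> exists2 e, e \in es & (e <= e')%MM.
Proof.
split=> [[u [_ ->]] e' /msupp_sum_le/flattenP[_ /mapP[i _ ->]]|hp].
  have lti : (i < size es)%N by rewrite -(size_map (fun e => 'X_[e] : P)).
  rewrite (nth_map 0%MM) // mulrC (perm_mem (msuppMX _ _)) => /mapP[e'' _ ->].
  by exists (nth 0%MM es i); [apply: mem_nth|apply: lem_addr].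
have hN : ideal (seq_mul (fun=> True) [seq 'X_[e] : P | e <- es]).
  exact: submodule_seq_mul.
have [N0 _ NZ] := hN; rewrite (mpolyE p); apply: (submodule_sum _ hN) => e'.
have [/hp[e ee le]|/memN_msupp_eq0 ->] := boolP (e' \in mpoly.msupp p);
  last first.
  by rewrite scale0r.
rewrite -(submK le) mpolyXD scalerAl; apply: NZ => //.
by apply: mem_seq_mul; apply: map_f.
Qed.

(** A monomial sharing no variable with the [j]-th one divides a product with it only if it divides
    the other factor; monomial ideals reduce the regularity test to this. *)
Lemma coprime_monomials_regular (es : seq 'X_{1..s}) :
  (forall e, e \in es -> e != 0%MM) ->
  (forall j i, (i < j < size es)%N -> forall t,
     nth 0%MM es i t = 0%N \/ nth 0%MM es j t = 0%N) ->
  regular_seq (fun=> True) [seq 'X_[e] : P | e <- es].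
Proof.
move=> es0 cop; split=> [j|]; last first.
  exists 1; split=> // /monomial_ideal_mem /(_ 0%MM).
  rewrite msupp1 mem_head => /(_ isT)[e /es0/negP ne /mnm_lepP le]; apply: ne.
  by apply/eqP/mnmP => i; have := le i; rewrite !mnm0E leqn0 => /eqP.
rewrite size_map => ltj y _; rewrite (nth_map 0%MM) // -map_take.
move=> /monomial_ideal_mem hy; apply/monomial_ideal_mem => e' e'y.
have [|e et le] := hy (nth 0%MM es j + e')%MM.
  by rewrite mulrC (perm_mem (msuppMX _ _)); apply: map_f.
exists e => //; apply/mnm_lepP => t; have /mnm_lepP/(_ t) := le.
have /(nthP 0%MM)[i] := et; rewrite (size_takel (ltnW ltj)) => ltij eE.
have [|e0|ej0] := cop j i _ t; first by rewrite ltij.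
  by rewrite -eE nth_take // e0.
by rewrite mnmDE ej0 add0n.
Qed.

Lemma monomial_regular_seq_embedding (xs : seq (sg_elt S)) :
  regular_seq (fun=> True) [seq mono x | x <- xs] ->
  regular_length (fun=> True) (extended_irrelevant_ideal K S phi sigma)
    (size xs).
Proof.
move=> reg; have colon := regular_monomials_colon reg.
have x1 := regular_monomials_neq1 reg.
exists [seq 'X_[e] | e <- [seq exponent x | x <- xs]]; split.
- by rewrite !size_map.
- rewrite -map_comp => _ /mapP[x xx ->] /=; rewrite -embedding_mono.
  apply: embedding_extended; apply/irrelevantE.
  by rewrite coef1_mono (negbTE (x1 x xx)).
- apply: coprime_monomials_regular => [_ /mapP[x xx ->]|j i].
    by apply: contraNneq (x1 x xx) => /std_exponent_eq0 ->.
  rewrite size_map => ltijs t; have /andP[ltij ltj] := ltijs.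
  rewrite !(nth_map (sg_one S)) ?(ltn_trans ltij) //.
  have cij := colon j i ltijs.
  have [le|/ltnW le] := leqP (exponent (nth (sg_one S) xs i) t)
    (exponent (nth (sg_one S) xs j) t).
    by left; apply: colon_trivial_coprime le.
  by right; apply: colon_trivial_coprime le; apply: colon_trivial_sym.
Qed.

Lemma monomial_length_max g :
  is_grade (extended_irrelevant_ideal K S phi sigma) g ->
  exists2 l, is_max (monomial_seq_length K S) l & (l <= g)%N.
Proof.
move=> [_ gmax].
have bound k : monomial_seq_length K S k -> (k <= g)%N.
  move=> [f [<- fm regf]].
  have [xs fE] : exists xs, f = [seq mono x | x <- xs].
    elim: f fm {regf} => [|a f IH] fm; first by exists [::].
    have [x ax] := fm a (mem_head _ _).
    have [b bf|xs ->] := IH; first by apply: fm; rewrite inE bf orbT.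
    by exists (x :: xs); rewrite /= -ax.
  rewrite fE size_map; apply: gmax; apply: monomial_regular_seq_embedding.
  by rewrite -fE.
have [|l lmax] := @bounded_max (monomial_seq_length K S) 0%N g _ bound.
  exists [::]; split=> //; apply: (@regular_seq_nil _ _ 1) => //.
  exact: oner_neq0.
by exists l => //; apply: bound; case: lmax.
Qed.

End Embedding.

Theorem theorem4p1 (F : realType) (K : fieldType) (n r s : nat)
    (S : posAffineSemigroup n) (hnormal : normal_semigroup S)
    (phi : 'rV[int]_n -> 'rV[int]_r) (hphi : gp_identification S phi)
    (sigma : 'M[int]_(r, s)) (hsigma : support_forms F S phi sigma) :
  exists (lambda g : nat) (d : class_group sigma -> nat),
    [/\ is_max (monomial_seq_length K S) lambda,
        is_grade (extended_irrelevant_ideal K S phi sigma) g,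
        forall c, is_local_depth (std_embedding K S phi sigma)
                    (irrelevant_ideal K S) (class_module K c) (d c),
        (lambda <= g)%N
      & is_min (fun k => exists c, k = d c) g].
Proof.
have [h hE] := std_embedding_rmorphism K hphi hsigma.
have [G [Gm hG]] := irrelevant_generators K S.
have [x [d [grade depth dmin]]] :=
  grade_eq_min_depth hnormal hphi hsigma hE Gm hG.
have [l lmax leg] := monomial_length_max hnormal hphi hsigma hE grade.
by exists l, (size x), d; rewrite -hE.
Qed.
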